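(* Let $Q$ be a concave BUM function, let $C_1,\dots,C_n$ be independent with $C_i$ uniformly distributed on $[\underline{c}_i,\overline{c}_i]$, $\underline{c}_i\ge 0$, let $\boldsymbol{c}^Q=(\rho_Q(C_1),\dots,\rho_Q(C_n))$, and let $\beta_L=2\int_0^1Q(t)\,dt$. If $\int_0^1 Q(t)\,dt$ and an optimal solution to the problem $\min_{\boldsymbol{x}\in\mathcal{X}}(\boldsymbol{c}^Q)^\top\boldsymbol{x}$ can be computed in polynomial time, then the problem $\min_{\boldsymbol{x}\in\mathcal{X}}\rho_Q(\boldsymbol{C}^\top\boldsymbol{x})$ is approximable within $\beta_L$.
   Context: A basic unit monotone (BUM) function is a function $Q:[0,1]\to[0,1]$ with $Q(0)=0$, $Q(1)=1$ and $Q(x)\ge Q(y)$ for $x>y$. For a random variable $Y$ with CDF $F_Y$, $\mathrm{VaR}_t(Y)=\inf\{y\in\mathbb{R}: F_Y(y)\ge t\}$ for $t\in(0,1]$ and $\mathrm{VaR}_0(Y)=\inf\{y\in\mathbb{R}:F_Y(y)>0\}$. The distortion risk measure is the Riemann–Stieltjes integral $\rho_Q(Y)=\int_0^1 \mathrm{VaR}_{1-t}(Y)\,dQ(t)$. $\mathcal{X}\subseteq\mathbb{R}^n_+$ is a set of feasible solutions and $\boldsymbol{C}=(C_1,\dots,C_n)^\top$. For $C_i$ uniform on $[\underline{c}_i,\overline{c}_i]$ one has $\rho_Q(C_i)=\underline{c}_i+(\overline{c}_i-\underline{c}_i)\int_0^1Q(t)\,dt$. A problem $\min_{\boldsymbol{x}\in\mathcal{X}}f(\boldsymbol{x})$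 is approximable within $\kappa$ if there is a polynomial-time algorithm that outputs $\boldsymbol{x}^*\in\mathcal{X}$ with $f(\boldsymbol{x}^* )\le\kappa f(\boldsymbol{x})$ for all $\boldsymbol{x}\in\mathcal{X}$. *)

(* Defs.v *)
From HB Require Import structures.
From mathcomp Require Import all_boot all_order all_algebra.
From mathcomp Require Import all_classical all_reals all_analysis.

Set Implicit Arguments.
Unset Strict Implicit.
Unset Printing Implicit Defensive.

Import Order.TTheory GRing.Theory Num.Theory.
Import numFieldNormedType.Exports.

Local Open Scope classical_set_scope.
Local Open Scope ring_scope.

Definition BUM (R : realType) (Q : R -> R) : Prop :=
  [/\ forall t, 0 <= t <= 1 -> 0 <= Q t <= 1,
      Q 0 = 0, Q 1 = 1 &
      forall x y, 0 <= x <= 1 -> 0 <= y <= 1 -> y < x -> Q y <= Q x].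

Definition concave_on01 (R : realType) (Q : R -> R) : Prop :=
  convex_function (`[0, 1] : set R^o) (fun t : R^o => - Q t).

(** [inf] is the real infimum: it is the usual one whenever the set is nonempty
    and bounded below, hence for every level in [[0, 1]] when [Y] is almost
    surely bounded. *)
Definition VaR d (T : measurableType d) (R : realType) (P : probability T R)
    (Y : {RV P >-> R}) (t : R) : R :=
  if t == 0 then inf [set y | (0 < cdf Y y)%E]
  else inf [set y | (t%:E <= cdf Y y)%E].

(** Riemann-Stieltjes integral as the limit of the tagged sums when the mesh
    tends to 0; the cells are [[nth b (a :: s) i, nth b (a :: s) i.+1]] for
    [i < size s]. *)
Definition is_RSint (R : realType) (a b : R) (g Q : R -> R) (v : R) : Prop :=
  forall e : R, 0 < e -> exists2 d : R, 0 < d &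
  forall (s : seq R) (xi : nat -> R),
    let t := nth b (a :: s) in
    itv_partition a b s ->
    (forall i, (i < size s)%N ->
       t i <= xi i <= t i.+1 /\ t i.+1 - t i < d) ->
    `| \sum_(i < size s) g (xi i) * (Q (t i.+1) - Q (t i)) - v | < e.

Definition RSint (R : realType) (a b : R) (g Q : R -> R) : R :=
  xget 0 [set v | is_RSint a b g Q v].

Definition rho d (T : measurableType d) (R : realType) (P : probability T R)
    (Q : R -> R) (Y : {RV P >-> R}) : R :=
  RSint 0 1 (fun t => VaR Y (1 - t)) Q.

Definition int01 (R : realType) (Q : R -> R) : R :=
  \int[lebesgue_measure]_(t in `[0, 1]) Q t.

(** Mutual independence: product rule on every subfamily. *)
Definition independent_RVs d (T : measurableType d) (R : realType)
    (P : probability T R) (n : nat) (C : 'I_n -> {RV P >-> R}) : Prop :=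
  forall (J : {set 'I_n}) (B : 'I_n -> set R),
    (forall i, measurable (B i)) ->
    P (\bigcap_(i in [set` J]) (C i @^-1` B i)) =
    (\prod_(i in J) P (C i @^-1` B i))%E.

(** On a degenerate interval [[a, a]] the uniform law is the Dirac mass at [a];
    [uniform_prob] is only available for [a < b]. *)
Definition uniform_on d (T : measurableType d) (R : realType)
    (P : probability T R) (a b : R) (X : {RV P >-> R}) : Prop :=
  [/\ a <= b,
      forall (ab : a < b) (A : set R), measurable A ->
        distribution P X A = uniform_prob ab A &
      a = b -> forall A : set R, measurable A -> distribution P X A = \d_a A].

(** Programs are first-order functional programs with iteration that transform
    data built from integers by pairing.  The cost is logarithmic: every
    elementary step is charged the bit size of what it reads and writes.  Since
    each step can be carried out by a Turing machine in time polynomial in its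
    charge, and a Turing machine configuration (tapes as nested pairs) can be
    updated by a program at a charge polynomial in its size, polynomial cost is
    the same as polynomial time on Turing machines. *)
Inductive data := DInt of int | DPair of data & data.

Fixpoint dsize (v : data) : nat :=
  match v with
  | DInt z => (trunc_log 2 `|z|%N).+1
  | DPair a b => (dsize a + dsize b).+1
  end.

Inductive prim :=
  PId | PConst of data | PFst | PSnd | PIsPair | PLeq | PAdd | PSub | PMul | PDiv.

Definition dbool (b : bool) : data := DInt (b : nat)%:Z.

(** The result is 0 on arguments of the wrong shape. *)
Definition prim_fun (o : prim) (v : data) : data :=
  match o, v with
  | PId, _ => v
  | PConst c, _ => c
  | PFst, DPair a _ => a
  | PSnd, DPair _ b => b
  | PIsPair, DPair _ _ => dbool true
  | PLeq, DPair (DInt x) (DInt y) => dbool (x <= y)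
  | PAdd, DPair (DInt x) (DInt y) => DInt (x + y)
  | PSub, DPair (DInt x) (DInt y) => DInt (x - y)
  | PMul, DPair (DInt x) (DInt y) => DInt (x * y)
  | PDiv, DPair (DInt x) (DInt y) => DInt (x %/ y)%Z
  | _, _ => DInt 0
  end.

Inductive prog :=
| Prim of prim
| Seq of prog & prog              (* first, then second *)
| Fork of prog & prog             (* run both on the input, pair the results *)
| If of prog & prog & prog
| While of prog & prog.           (* condition, body *)

Definition dtrue (v : data) : bool :=
  if v is DInt (Posz 0) then false else true.

(** [exec p v w t]: on input [v], [p] halts with output [w] at cost [t]. *)
Inductive exec : prog -> data -> data -> nat -> Prop :=
| EPrim o v :
    exec (Prim o) v (prim_fun o v) (dsize v + dsize (prim_fun o v))
| ESeq p q v u w t1 t2 :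
    exec p v u t1 -> exec q u w t2 -> exec (Seq p q) v w (t1 + t2).+1
| EFork p q v a b t1 t2 :
    exec p v a t1 -> exec q v b t2 ->
    exec (Fork p q) v (DPair a b) (t1 + t2 + dsize v + dsize (DPair a b))
| EIfT c p q v b w t1 t2 :
    exec c v b t1 -> dtrue b -> exec p v w t2 ->
    exec (If c p q) v w (t1 + t2 + dsize v)
| EIfF c p q v b w t1 t2 :
    exec c v b t1 -> ~~ dtrue b -> exec q v w t2 ->
    exec (If c p q) v w (t1 + t2 + dsize v)
| EWhileF c p v b t1 :
    exec c v b t1 -> ~~ dtrue b -> exec (While c p) v v (t1 + dsize v)
| EWhileT c p v b u w t1 t2 t3 :
    exec c v b t1 -> dtrue b -> exec p v u t2 -> exec (While c p) u w t3 ->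
    exec (While c p) v w (t1 + t2 + t3 + dsize v).

(** One program, with one polynomial bound, answers all inputs [v] presenting
    an [a] in [D] by an output that is correct for [a]. *)
Definition polytime (A : Type) (D : A -> Prop) (input output : A -> data -> Prop)
    : Prop :=
  exists (p : prog) (q : {poly nat}), forall a v, D a -> input a v ->
    exists w t, [/\ exec p v w t, (t <= q.[dsize v])%N & output a w].

Definition dlist : seq data -> data := foldr DPair (DInt 0).

Definition code_rat (r : rat) : data := DPair (DInt (numq r)) (DInt (denq r)).

Definition code_vec n (c : 'rV[rat]_n) : data :=
  dlist [seq code_rat (c ord0 i) | i <- enum 'I_n].

(** A computed number is a fraction, not necessarily in lowest terms; in
    particular it is rational. *)
Definition encodes_num (R : realType) (v : data) (x : R) : Prop :=
  exists a b : int,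
    [/\ v = DPair (DInt a) (DInt b), 0 < b & x = a%:~R / b%:~R].

Definition encodes_vec (R : realType) n (v : data) (x : 'rV[R]_n) : Prop :=
  exists2 s : n.-tuple data, v = dlist s &
    forall i, encodes_num (tnth s i) (x ord0 i).

(** An instance: the feasible set, the distortion function and the random costs
    with their supports, together with a description [desc], in whatever format,
    of the feasible set and of the distortion function. *)
Record instance (R : realType) := Instance {
  nvar : nat ;
  feas : set 'rV[R]_nvar ;
  distortion : R -> R ;
  lo : 'rV[rat]_nvar ;
  hi : 'rV[rat]_nvar ;
  disp : measure_display ;
  space : measurableType disp ;
  prob : probability space R ;
  cost : 'I_nvar -> {RV prob >-> R} ;
  desc : data
}.
Arguments instance : clear implicits.
Arguments feas {R} I _ : rename.
Arguments cost {R} I _ : rename.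

Definition code (R : realType) (I : instance R) : data :=
  DPair (DPair (code_vec (lo I)) (code_vec (hi I))) (desc I).

Definition total_cost (R : realType) (I : instance R) (x : 'rV[R]_(nvar I)) :
    {RV prob I >-> R} :=
  \sum_(i < nvar I) x ord0 i *: (cost I i : {mfun space I >-> R}).

Definition risk (R : realType) (I : instance R) (x : 'rV[R]_(nvar I)) : R :=
  rho (distortion I) (total_cost x).

Definition cQ (R : realType) (I : instance R) : 'rV[R]_(nvar I) :=
  \row_i rho (distortion I) (cost I i).

Definition linear_cost (R : realType) (I : instance R) (x : 'rV[R]_(nvar I)) : R :=
  \sum_(i < nvar I) cQ I ord0 i * x ord0 i.

Definition betaL (R : realType) (I : instance R) : R := 2 * int01 (distortion I).

Definition minimizer (R : realType) (I : instance R)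
    (f : 'rV[R]_(nvar I) -> R) (x : 'rV[R]_(nvar I)) : Prop :=
  feas I x /\ forall y, feas I y -> f x <= f y.

Definition presents (R : realType) (I : instance R) (v : data) : Prop :=
  v = code I.

(** The linear problem is given the instance and its cost vector [cQ], the
    latter in any of its encodings. *)
Definition presents_linear (R : realType) (I : instance R) (v : data) : Prop :=
  exists2 u, v = DPair (code I) u & encodes_vec u (cQ I).

(** The ratio may depend on the instance, as [betaL] does through the distortion
    function. *)
Definition approximable (R : realType) (Pb : instance R -> Prop)
    (f : forall I : instance R, 'rV[R]_(nvar I) -> R) (kappa : instance R -> R)
    : Prop :=
  polytime Pb (@presents R) (fun I w => exists x : 'rV[R]_(nvar I),
    [/\ encodes_vec w x, feas I x &
        forall y, feas I y -> f I x <= kappa I * f I y]).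

(* Main.v *)
(** The minimizer x of the linear problem is a good solution of the risk problem
    because rho(C^T x) <= (c^Q)^T x <= (c^Q)^T y <= beta_L E[C^T y] <= beta_L rho(C^T y)
    for every feasible y.  The first step is subadditivity of rho, the last one holds
    because a concave distortion satisfies Q(t) >= t, and the third one is the explicit
    value of rho on uniform laws together with 2 int Q >= 1.

    Subadditivity and E <= rho are proved on Riemann-Stieltjes sums over the grids i / (n + 1).
    The stop-loss transform pi(a) = E (Y - a)^+ is subadditive, and comparing its
    increments with the distribution function bounds sums of quantiles by pi on both sides;
    summation by parts against the nonincreasing increments of Q then gives the claim for rho.

    On the algorithmic side, c^Q is computed from the supports and int Q by a loop of
    exact fraction arithmetic. *)

Require Import Defs.
From HB Require Import structures.
From mathcomp Require Import all_boot all_order all_algebra.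
From mathcomp Require Import all_classical all_reals all_analysis.
From mathcomp Require Import ring lra zify measurable_realfun.

Set Implicit Arguments.
Unset Strict Implicit.
Unset Printing Implicit Defensive.

Import Order.TTheory GRing.Theory Num.Theory.
Import numFieldNormedType.Exports.

Local Open Scope classical_set_scope.
Local Open Scope ring_scope.

(** * Riemann-Stieltjes sums *)

Section Concave.
Variables (R : realType) (Q : R -> R).
Hypotheses (BQ : BUM Q) (cQ : concave_on01 Q).

Lemma concave_on01P (p x y : R) : 0 <= p <= 1 -> 0 <= x <= 1 -> 0 <= y <= 1 ->
  p * Q x + (1 - p) * Q y <= Q (p * x + (1 - p) * y).
Proof.
move=> /andP[p0 p1] x01 y01.
have /(_ x y) := cQ (Itv01 p0 p1).
rewrite !inE/= !in_itv/= x01 y01 => /(_ erefl erefl).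
rewrite convRE /= /unstable.onem => h.
have -> : p * x + (1 - p) * y =
  conv (Itv01 p0 p1) (x : convex_lmodType R^o) (y : convex_lmodType R^o) by [].
lra.
Qed.

Lemma BUM_homo (x y : R) : 0 <= x -> x <= y -> y <= 1 -> Q x <= Q y.
Proof.
move=> x0; rewrite le_eqVlt => /predU1P[->//|xy] y1.
case: BQ => _ _ _; apply => //; rewrite ?y1 ?x0 ?andbT /=.
- by apply: le_trans x0 (ltW xy).
- by apply: le_trans (ltW xy) y1.
Qed.

(** The graph of [Q] lies above its chord from [(0, 0)] to [(1, 1)]. *)
Lemma concave_ge_id (t : R) : 0 <= t <= 1 -> t <= Q t.
Proof.
case: BQ => _ Q0 Q1 _ t01.
have := @concave_on01P t 1 0 t01.
rewrite Q0 Q1 !ler01 !lexx /= => /(_ erefl erefl).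
by rewrite !mulr1 !mulr0 !addr0.
Qed.

(** The chord from [0] to [y] gives [Q x >= (x / y) * Q y], and [Q y <= 1]. The constant degenerates
    at [0], where [Q] may jump. *)
Lemma concave_lipschitz (eta x y : R) : 0 < eta -> eta <= x -> x <= y -> y <= 1 ->
  Q y - Q x <= (y - x) / eta.
Proof.
case: BQ => Q01 Q0 Q1 _ eta0 ex xy y1.
have x0 : 0 < x by apply: lt_le_trans ex.
have y0 : 0 < y by apply: lt_le_trans xy.
have xy01 : 0 <= x / y <= 1.
  by rewrite ler_pdivrMr// mul1r xy divr_ge0// ltW.
have := @concave_on01P (x / y) y 0 xy01.
rewrite Q0 !mulr0 !addr0 divfK ?gt_eqF// (ltW y0) y1 lexx ler01 => /(_ erefl erefl) h.
have /andP[_ Qy1] : 0 <= Q y <= 1 by apply: Q01; rewrite ltW ?y1.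
apply: (@le_trans _ _ ((1 - x / y) * Q y)); first by lra.
apply: (@le_trans _ _ (1 - x / y)).
  by rewrite ler_piMr//; case/andP: xy01; lra.
have -> : 1 - x / y = (y - x) / y by field; rewrite gt_eqF.
by apply: ler_wpM2l; rewrite ?subr_ge0// lef_pV2// (le_trans ex xy).
Qed.

(** Concavity at the midpoint [x + h] of [x] and [x + h + h]. *)
Lemma concave_increments (x h : R) : 0 <= x -> 0 <= h -> x + h + h <= 1 ->
  Q (x + h + h) - Q (x + h) <= Q (x + h) - Q x.
Proof.
move=> x0 h0 x1.
have := @concave_on01P (2^-1) x (x + h + h)
  ltac:(by apply/andP; split; lra) ltac:(by apply/andP; split; lra)
  ltac:(by apply/andP; split; lra).
have -> : 2^-1 * x + (1 - 2^-1) * (x + h + h) = x + h :> R by field.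
lra.
Qed.

End Concave.

(** * Existence of the integral of a nonincreasing function *)

Section RiemannStieltjes.
Variables (R : realType) (g Q : R -> R).
Hypotheses (BQ : BUM Q) (cQ : concave_on01 Q).
Hypothesis (gle : forall x y, 0 <= x -> x <= y -> y <= 1 -> g y <= g x).

(** As [g] is nonincreasing, right ends give lower sums. The default [1] of [nth] is never read; it
    agrees with the one in [is_RSint 0 1]. *)
Definition RSlower (a : R) (s : seq R) : R :=
  \sum_(i < size s) g (nth 1 (a :: s) i.+1) *
    (Q (nth 1 (a :: s) i.+1) - Q (nth 1 (a :: s) i)).

Definition RSupper (a : R) (s : seq R) : R :=
  \sum_(i < size s) g (nth 1 (a :: s) i) *
    (Q (nth 1 (a :: s) i.+1) - Q (nth 1 (a :: s) i)).

Lemma RSlower_cons a b s : RSlower a (b :: s) = g b * (Q b - Q a) + RSlower b s.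
Proof. by rewrite /RSlower /= big_ord_recl. Qed.

Lemma RSupper_cons a b s : RSupper a (b :: s) = g a * (Q b - Q a) + RSupper b s.
Proof. by rewrite /RSupper /= big_ord_recl. Qed.

Lemma path_le_last (a : R) s : path <%O a s -> a <= last a s.
Proof.
elim: s a => //= b s IH a /andP[ab /IH]; apply: le_trans; exact: ltW.
Qed.

(** Induction on the total number of points replaces a common refinement: the nearer of the first
    points [b] and [b'] is split off and becomes the left end of both remaining partitions. *)
Lemma RSlower_le_upper a s s' : 0 <= a -> path <%O a s -> path <%O a s' ->
  last a s = 1 -> last a s' = 1 -> RSlower a s <= RSupper a s'.
Proof.
have [n] := ubnP (size s + size s').
elim: n a s s' => // n IH a [|b s] [|b' s'] //= ltn a0.
- by rewrite /RSlower /RSupper /= !big_ord0.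
- move=> _ /andP[ab' p'] a1 h; have := path_le_last p'.
  by rewrite h => /(lt_le_trans ab'); rewrite a1 ltxx.
- move=> /andP[ab p] _ h a1; have := path_le_last p.
  by rewrite h => /(lt_le_trans ab); rewrite a1 ltxx.
move=> /andP[ab p] /andP[ab' p'] l l'.
have b1 : b <= 1 by rewrite -l; exact: path_le_last.
have b'1 : b' <= 1 by rewrite -l'; exact: path_le_last.
have b0 : 0 <= b by apply: le_trans a0 (ltW ab).
have b'0 : 0 <= b' by apply: le_trans a0 (ltW ab').
rewrite RSlower_cons RSupper_cons.
have Qab : Q a <= Q b by apply: BUM_homo => //; exact: ltW.
have Qab' : Q a <= Q b' by apply: BUM_homo => //; exact: ltW.
have gab : g b <= g a by apply: gle => //; exact: ltW.
have gab' : g b' <= g a by apply: gle => //; exact: ltW.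
have gQ : 0 <= (g a - g b) * (Q b' - Q a) by rewrite mulr_ge0 ?subr_ge0.
have sz1 : (size s + size (b' :: s') < n)%N by [].
have sz2 : (size (b :: s) + size s' < n)%N by rewrite addSnnS.
have sz3 : (size s + size s' < n)%N by apply: leq_trans sz2; rewrite ltnS leq_add2r.
have [bb'|bb'|bb'] := ltgtP b b'.
- have : RSlower b s <= RSupper b (b' :: s').
    by apply: (IH _ _ _ sz1 b0 p _ l l'); rewrite /= bb'.
  rewrite RSupper_cons; lra.
- have : RSlower b' (b :: s) <= RSupper b' s'.
    by apply: (IH _ _ _ sz2 b'0 _ p' l l'); rewrite /= bb'.
  rewrite RSlower_cons; lra.
- rewrite -bb' in p' l' gQ *.
  have := IH _ _ _ sz3 b0 p p' l l'.
  lra.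
Qed.

(* Cells near 0, where [Q] may jump, are controlled by the continuity of [g] at 0;
   beyond [eta], [Q] is Lipschitz. *)
Lemma is_RSint_ex :
  (forall e, 0 < e -> exists2 d, 0 < d <= 1 & g 0 - g d <= e) ->
  exists v, is_RSint 0 1 g Q v.
Proof.
move=> gcont.
pose A := [set v | exists2 s, itv_partition 0 1 s & v = RSlower 0 s].
have part1 : itv_partition (0 : R) 1 [:: 1] by rewrite /itv_partition /= ltr01 eqxx.
have ubA s : itv_partition 0 1 s -> ubound A (RSupper 0 s).
  move=> [ps /eqP ls] _ [s' [ps' /eqP ls'] ->].
  exact: RSlower_le_upper.
have hA : has_sup A.
  split; first by exists (RSlower 0 [:: 1]); exists [:: 1].
  by exists (RSupper 0 [:: 1]); exact: ubA.
(* The integral is the supremum of the lower sums, and every upper sum bounds it from above. *)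
exists (sup A) => e e0.
have [de /andP[de0 de1] gde] := gcont (e / 4) ltac:(by rewrite divr_gt0).
pose G := g 0 - g 1.
have G0 : 0 <= G by rewrite subr_ge0 gle.
pose eta := de / 2.
have eta0 : 0 < eta by rewrite divr_gt0.
(* A cell that starts before [eta] then ends before [de = 2 * eta], and the second bound gives
   [d / eta * G <= e / 4]. *)
pose d := Num.min eta (eta * (e / (4 * (G + 1)))).
have d0 : 0 < d.
  rewrite lt_min eta0 mulr_gt0// divr_gt0// mulr_gt0//; lra.
exists d => // s xi t part mesh.
have [pats /eqP lasts] := part.
have tS i : (i < size s)%N -> t i < t i.+1.
  by move=> si; have /pathP /(_ i si) := pats; apply.
have tle i j : (i <= j)%N -> (j <= size s)%N -> t i <= t j.
  elim: j => [|j IH]; first by rewrite leqn0 => /eqP ->.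
  rewrite leq_eqVlt => /predU1P[->//|ij] js.
  by apply: le_trans (IH _ _) (ltW (tS _ js)) => //; apply: ltnW.
have t0 : t 0%N = 0 by [].
have t1 : t (size s) = 1.
  by rewrite -[RHS]lasts (last_nth 1).
have t01 i : (i <= size s)%N -> 0 <= t i <= 1.
  by move=> si; rewrite -{1}t0 -t1 !tle.
pose T := \sum_(i < size s) g (xi i) * (Q (t i.+1) - Q (t i)).
have dQ i : (i < size s)%N -> 0 <= Q (t i.+1) - Q (t i).
  move=> si; rewrite subr_ge0; apply: BUM_homo => //.
  - by case/andP: (t01 i (ltnW si)).
  - by apply: ltW; exact: tS.
  - by case/andP: (t01 i.+1 si).
have LT : RSlower 0 s <= T.
  apply: ler_sum => i _; apply: ler_wpM2r; first exact: dQ.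
  have [/andP[h1 h2] _] := mesh i (ltn_ord i).
  apply: gle => //; last by case/andP: (t01 i.+1 (ltn_ord i)).
  by apply: le_trans h1; case/andP: (t01 i (ltnW (ltn_ord i))).
have TU : T <= RSupper 0 s.
  apply: ler_sum => i _; apply: ler_wpM2r; first exact: dQ.
  have [/andP[h1 h2] _] := mesh i (ltn_ord i).
  apply: gle => //; first by case/andP: (t01 i (ltnW (ltn_ord i))).
  by apply: le_trans h2 _; case/andP: (t01 i.+1 (ltn_ord i)).
have Lv : RSlower 0 s <= sup A by apply: ub_le_sup; [case: hA|exists s].
have vU : sup A <= RSupper 0 s by apply: ge_sup; [case: hA|exact: ubA].
have UL : RSupper 0 s - RSlower 0 s <= e / 4 + d / eta * G.
  (* The bound is spread over the cells by telescoping, as [Q] rises by [1] and [g] drops by [G] in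
     total. A cell starting at or beyond [eta] is paid for by its second term, the others by the
     first. *)
  have -> : e / 4 + d / eta * G =
     \sum_(i < size s) (e / 4 * (Q (t i.+1) - Q (t i)) - d / eta * (g (t i.+1) - g (t i))).
    rewrite big_split /= sumrN -!mulr_sumr.
    rewrite -(big_mkord xpredT (fun i => Q (t i.+1) - Q (t i))).
    rewrite -(big_mkord xpredT (fun i => g (t i.+1) - g (t i))).
    rewrite !telescope_sumr// t1 t0.
    by case: BQ => _ -> -> _; rewrite /G; ring.
  rewrite -sumrB; apply: ler_sum => i _; rewrite -mulrBl.
  have si := ltn_ord i.
  have /andP[ti0 ti1] := t01 i (ltnW si).
  have /andP[si0 si1] := t01 i.+1 si.
  have titi := tS i si.
  have [_ tid] := mesh i si.
  have dgi : 0 <= g (t i) - g (t i.+1) by rewrite subr_ge0 gle// ltW.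
  have dQi := dQ i si.
  have de' : 0 <= d / eta by rewrite divr_ge0// ltW.
  rewrite -/(t i) -/(t i.+1).
  have [et|et] := leP eta (t i).
    have := concave_lipschitz BQ cQ eta0 et (ltW titi) si1.
    have : (t i.+1 - t i) / eta <= d / eta by rewrite ler_pM2r ?invr_gt0// ltW.
    nra.
  have : g (t i) - g (t i.+1) <= e / 4.
    apply: le_trans gde; rewrite lerB//; apply: gle => //.
    have : d <= eta by rewrite ge_min lexx.
    rewrite /eta in et *; lra.
  nra.
have dG : d / eta * G <= e / 4.
  have : d / eta <= e / (4 * (G + 1)).
    by rewrite ler_pdivrMr// mulrC ge_min lexx orbT.
  have G1 : 0 < G + 1 by lra.
  move=> h.
  apply: (@le_trans _ _ (e / (4 * (G + 1)) * (G + 1))).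
    apply: ler_pM => //; first by rewrite divr_ge0// ltW.
    lra.
  by rewrite invfM !mulrA divfK// gt_eqF.
rewrite -/T ltr_norml; apply/andP; split; lra.
Qed.

End RiemannStieltjes.

(** * Uniform grids, summation by parts and Riemann sums *)

Section Grid.
Variable R : realType.

Definition grid (n i : nat) : R := i%:R / n.+1%:R.

Lemma grid0 n : grid n 0 = 0. Proof. by rewrite /grid mul0r. Qed.

Lemma grid1 n : grid n n.+1 = 1. Proof. by rewrite /grid divff. Qed.

Lemma gridS n i : grid n i.+1 = grid n i + n.+1%:R^-1.
Proof. by rewrite /grid -natr1 mulrDl mul1r. Qed.

Lemma grid_lt n i : grid n i < grid n i.+1.
Proof. by rewrite gridS ltrDl invr_gt0. Qed.

Lemma grid_le n i j : (i <= j)%N -> grid n i <= grid n j.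
Proof. by move=> ij; rewrite ler_wpM2r// ler_nat. Qed.

Lemma grid01 n i : (i <= n.+1)%N -> 0 <= grid n i <= 1.
Proof. by move=> ?; rewrite -{1}(grid0 n) -(grid1 n) !grid_le. Qed.

(** The mesh [1 / (n + 1)] tends to [0], so the limit over all partitions is also the limit along
    the grids, whatever the tags. *)
Lemma is_RSint_grid (g Q : R -> R) (v : R) (xi : nat -> nat -> R) :
  is_RSint 0 1 g Q v ->
  (forall n i, (i <= n)%N -> grid n i <= xi n i <= grid n i.+1) ->
  (fun n => \sum_(i < n.+1) g (xi n i) * (Q (grid n i.+1) - Q (grid n i)))
    @ \oo --> v.
Proof.
move=> vP xiP; apply/cvgrPdist_lt => e e0.
have [d d0 {}vP] := vP e e0.
near=> n.
pose s := [seq grid n i | i <- iota 1 n.+1].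
have sE i : (i <= n.+1)%N -> nth 1 (0 :: s) i = grid n i.
  case: i => [|i] ltin; first by rewrite /= grid0.
  by rewrite /= (nth_map 0%N) ?size_iota// nth_iota// add1n.
have szs : size s = n.+1 by rewrite size_map size_iota.
have := vP s (xi n); rewrite szs => {}vP.
rewrite distrC; under eq_bigr => i _.
  rewrite -(sE i.+1) // -(sE i) ?(ltnW (ltn_ord i))//; over.
apply: vP.
  split.
    apply/(pathP 1) => i; rewrite szs => ltin.
    have -> : nth 1 s i = nth 1 (0 :: s) i.+1 by [].
    by rewrite !sE ?grid_lt// ltnW.
  rewrite (last_nth 1) szs sE// grid1//.
move=> i ltin; rewrite !sE// ?(ltnW ltin)//; split; first exact: xiP.
rewrite gridS addrAC subrr add0r.
near: n; exact: near_infty_natSinv_lt (PosNum d0).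
Unshelve. all: by end_near. Qed.

Lemma abel_sum (D S : nat -> R) n :
  \sum_(i < n.+1) (S i.+1 - S i) * D i =
  S n.+1 * D n - S 0%N * D 0%N + \sum_(i < n) S i.+1 * (D i - D i.+1).
Proof.
elim: n => [|n IH]; first by rewrite big_ord_recr !big_ord0 /=; ring.
by rewrite big_ord_recr /= IH [in RHS]big_ord_recr /=; ring.
Qed.

(** Summation by parts turns each side into a combination of its partial sums with the nonnegative
    weights [D n] and [D i - D i.+1]. *)
Lemma ler_abel_sum (D a b : nat -> R) n :
  (forall i, (i < n)%N -> D i.+1 <= D i) -> 0 <= D n ->
  (forall k, (k <= n.+1)%N -> \sum_(i < k) a i <= \sum_(i < k) b i) ->
  \sum_(i < n.+1) a i * D i <= \sum_(i < n.+1) b i * D i.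
Proof.
move=> Ddecr Dn ab.
have H (c : nat -> R) : \sum_(i < n.+1) c i * D i =
    (\sum_(i < n.+1) c i) * D n + \sum_(i < n) (\sum_(j < i.+1) c j) * (D i - D i.+1).
  have := abel_sum D (fun k => \sum_(i < k) c i) n.
  rewrite [\sum_(i < 0) _]big_ord0 mul0r subr0 => <-.
  by apply: eq_bigr => i _; rewrite big_ord_recr /= addrAC subrr add0r.
rewrite !H lerD//; first by rewrite ler_wpM2r// ab.
apply: ler_sum => i _; rewrite ler_wpM2r ?subr_ge0 ?Ddecr// ab//.
by rewrite ltnS ltnW.
Qed.

(** The left and right Riemann sums of the monotone [Q] enclose the integral and differ by
    [(Q 1 - Q 0) / (n + 1)]. *)
Lemma int01_grid (Q : R -> R) : BUM Q ->
  (fun n => \sum_(i < n.+1) Q (grid n i) / n.+1%:R) @ \oo --> int01 Q.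
Proof.
move=> BQ.
have Q01 t : 0 <= t <= 1 -> 0 <= Q t <= 1 by case: BQ => + _ _ _; exact.
pose mu := @lebesgue_measure R.
(* Freezing [Q] outside [[0, 1]] makes it monotone on the whole line, hence measurable. *)
pose Q' t := Q (Num.max 0 (Num.min t 1)).
have clamp01 (t : R) : 0 <= Num.max 0 (Num.min t 1) <= 1.
  by rewrite le_max lexx/= ge_max ler01 ge_min lexx orbT.
have Q'E t : 0 <= t <= 1 -> Q' t = Q t.
  by move=> /andP[t0 t1]; rewrite /Q' (min_idPl t1) (max_idPr t0).
have Q'h : {homo Q' : x y / x <= y}.
  move=> x y xy; have /andP[x0 _] := clamp01 x; have /andP[_ y1] := clamp01 y.
  by apply: (BUM_homo BQ x0 _ y1); rewrite le_max2 // le_min2.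
have Q'01 t : 0 <= Q' t <= 1 by apply: Q01.
have IE : int01 Q = \int[mu]_(t in `[0, 1]) Q' t.
  by apply: eq_Rintegral => t; rewrite inE/= in_itv/= => /Q'E.
have mQ' D : measurable D -> measurable_fun D Q'.
  by move=> mD; exact: nondecreasing_measurable.
have ibnd (f : R -> R) M (a b : R) (ba bb : bool) :
    measurable_fun setT f -> (forall t, `|f t| <= M) ->
    mu.-integrable [set` Interval (BSide ba a) (BSide bb b)] (EFin \o f).
  move=> mf fM; apply: measurable_bounded_integrable => //; last 2 first.
  - exact: measurable_funTS.
  - exists M; split=> [|x Mx t _ /=]; first exact: num_real.
    exact: le_trans (ltW Mx).
  - rewrite [ltLHS]lebesgue_measure_itv /=; case: ifP => // _.
    by rewrite -EFinD ltry.
have iQ' (a b : R) (ba bb : bool) :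
    mu.-integrable [set` Interval (BSide ba a) (BSide bb b)] (EFin \o Q').
  apply: (@ibnd _ 1) => [|t]; first exact: mQ'.
  by have /andP[? ?] := Q'01 t; rewrite ger0_norm.
have mucell n i : mu `]grid n i, grid n i.+1]%classic = (n.+1%:R^-1)%:E.
  by rewrite [LHS]lebesgue_measure_itv/= lte_fin grid_lt gridS -EFinD addrAC subrr add0r.
have cellcst n i (c : R) : \int[mu]_(t in `]grid n i, grid n i.+1]) c = c / n.+1%:R.
  transitivity (c * fine (mu `]grid n i, grid n i.+1]%classic)); last by rewrite mucell.
  exact: Rintegral_cst.
have bnd n i : Q' (grid n i) / n.+1%:R <= \int[mu]_(t in `]grid n i, grid n i.+1]) Q' t
    <= Q' (grid n i.+1) / n.+1%:R.
  have icst (c : R) : mu.-integrable `]grid n i, grid n i.+1]%classic (EFin \o cst c).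
    by apply: (@ibnd _ `|c|).
  rewrite -!(cellcst n i); apply/andP; split; apply: le_Rintegral => //; do ?[exact: icst|exact: iQ'].
  - by move=> t; rewrite /= in_itv/= => /andP[? ?]; apply: Q'h; rewrite ltW.
  - by move=> t; rewrite /= in_itv/= => /andP[? ?]; apply: Q'h.
have split n k : \int[mu]_(t in `[0, grid n k]) Q' t =
    \sum_(i < k) \int[mu]_(t in `]grid n i, grid n i.+1]) Q' t.
  elim: k => [|k IH]; first by rewrite big_ord0 grid0 set_itv1 Rintegral_set1.
  rewrite big_ord_recr /= -IH -(Rintegral_itvB (iQ' 0 (grid n k.+1) true false)).
  - by rewrite addrC subrK.
  - by rewrite bnd_simp -(grid0 n) grid_le.
  - by rewrite bnd_simp grid_le.
have QE n i : (i <= n.+1)%N -> Q' (grid n i) = Q (grid n i).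
  by move=> ltin; rewrite Q'E// grid01.
have IEn n : int01 Q = \int[mu]_(t in `[0, grid n n.+1]) Q' t by rewrite grid1.
have low n : \sum_(i < n.+1) Q (grid n i) / n.+1%:R <= int01 Q.
  rewrite (IEn n) split; apply: ler_sum => i _.
  have /andP[h _] := bnd n i.
  by rewrite -(QE n i (ltnW (ltn_ord i))).
have up n : int01 Q <= \sum_(i < n.+1) Q (grid n i) / n.+1%:R + n.+1%:R^-1.
  have -> : \sum_(i < n.+1) Q (grid n i) / n.+1%:R + n.+1%:R^-1 =
      \sum_(i < n.+1) Q (grid n i.+1) / n.+1%:R.
    case: BQ => _ Q0 Q1 _.
    rewrite big_ord_recl [RHS]big_ord_recr /= grid0 grid1 Q0 Q1 mul0r add0r mul1r.
    by [].
  rewrite (IEn n) split; apply: ler_sum => i _.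
  have /andP[_ h] := bnd n i.
  by rewrite -(QE n i.+1 (ltn_ord i)).
apply/cvgrPdist_lt => e e0; near=> n.
have lowr : n.+1%:R^-1 < e by near: n; exact: near_infty_natSinv_lt (PosNum e0).
have := low n; have := up n.
set S := \sum_(i < n.+1) _ => Sup Slow.
rewrite ger0_norm ?subr_ge0// ltrBlDl.
by apply: le_lt_trans Sup _; rewrite ltrD2l.
Unshelve. all: by end_near. Qed.

End Grid.

(** * Quantiles and the stop-loss transform *)

Section StopLoss.
Context d (T : measurableType d) (R : realType) (P : probability T R).
Implicit Type Y : {RV P >-> R}.

Definition stop_loss_e Y (a : R) : \bar R := (\int[P]_w (Num.max (Y w - a) 0)%:E)%E.
(* Meaningless if [Y] has no upper mean, since [fine] sends [+oo] to 0. *)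
Definition stop_loss Y (a : R) : R := fine (stop_loss_e Y a).

Lemma measurable_excess Y (a : R) :
  measurable_fun setT (fun w => (Num.max (Y w - a) 0)%:E).
Proof.
apply/measurable_EFinP; apply: measurable_maxr => //.
exact: measurable_funB.
Qed.

Lemma excess_ge0 Y (a : R) w : (0 <= (Num.max (Y w - a) 0)%:E)%E.
Proof. by rewrite lee_fin le_max lexx orbT. Qed.

Lemma cdf_fin Y y : cdf Y y = (fine (cdf Y y))%:E.
Proof. by rewrite fineK// fin_num_measure. Qed.

Lemma integral_tail_indic Y c k : 0 <= k ->
  (\int[P]_w (k * \1_(Y @^-1` `]c, +oo[) w)%:E)%E = (k * (1 - fine (cdf Y c)))%:E.
Proof.
move=> k0.
have mA : measurable (Y @^-1` `]c, +oo[).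
  by rewrite -[X in measurable X]setTI; exact: measurable_funP.
under eq_integral do rewrite EFinM.
rewrite ge0_integralZl_EFin//.
- rewrite integral_indic// setIT EFinM; congr (_ * _)%E.
  have := cdf_ccdf_1 Y c; rewrite cdf_fin EFinB => <-.
  by rewrite addeAC subee// add0e.
- by apply/measurable_EFinP; exact: measurable_indic.
Qed.

(** Integrates [(Y - c)^+ <= (Y - b)^+ + (b - c) * 1_{Y > c}]. With the next bound, the transform
    decreases from [c] to [b] at a mean rate between the tail probabilities at [b] and at [c]. *)
Lemma stop_loss_e_le Y c b : c <= b ->
  (stop_loss_e Y c <= stop_loss_e Y b + ((b - c) * (1 - fine (cdf Y c)))%:E)%E.
Proof.
move=> cb; have bc0 : 0 <= b - c by rewrite subr_ge0.
have mA : measurable (Y @^-1` `]c, +oo[).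
  by rewrite -[X in measurable X]setTI; exact: measurable_funP.
have mI : measurable_fun setT (fun w => ((b - c) * \1_(Y @^-1` `]c, +oo[) w)%:E).
  by apply/measurable_EFinP; apply: measurable_funM => //; exact: measurable_indic.
rewrite -integral_tail_indic// /stop_loss_e -ge0_integralD//; last 3 first.
- by move=> w _; exact: excess_ge0.
- exact: measurable_excess.
- by move=> w _; rewrite lee_fin mulr_ge0.
apply: ge0_le_integral => //.
- by move=> w _; exact: excess_ge0.
- exact: measurable_excess.
- by apply: emeasurable_funD => //; exact: measurable_excess.
move=> w _; rewrite -EFinD lee_fin indicE.
have [/set_mem|/negP] := boolP (w \in _); rewrite ?inE/= in_itv/= andbT => h.
  rewrite mulr1 ge_max; apply/andP; split.
    have : Y w - b <= Num.max (Y w - b) 0 by rewrite le_max lexx.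
    lra.
  have : 0 <= Num.max (Y w - b) 0 by rewrite le_max lexx orbT.
  lra.
move/negP : h; rewrite -leNgt => h.
have -> : Num.max (Y w - c) 0 = 0 by apply/max_idPr; rewrite subr_le0.
by rewrite mulr0 addr0 le_max lexx orbT.
Qed.

(** Integrates [(Y - b)^+ + (b - c) * 1_{Y > b} <= (Y - c)^+]. *)
Lemma stop_loss_e_ge Y c b : c <= b ->
  (stop_loss_e Y b + ((b - c) * (1 - fine (cdf Y b)))%:E <= stop_loss_e Y c)%E.
Proof.
move=> cb; have bc0 : 0 <= b - c by rewrite subr_ge0.
have mA : measurable (Y @^-1` `]b, +oo[).
  by rewrite -[X in measurable X]setTI; exact: measurable_funP.
have mI : measurable_fun setT (fun w => ((b - c) * \1_(Y @^-1` `]b, +oo[) w)%:E).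
  by apply/measurable_EFinP; apply: measurable_funM => //; exact: measurable_indic.
rewrite -integral_tail_indic// /stop_loss_e -ge0_integralD//; last 3 first.
- by move=> w _; exact: excess_ge0.
- exact: measurable_excess.
- by move=> w _; rewrite lee_fin mulr_ge0.
apply: ge0_le_integral => //.
- by move=> w _; rewrite adde_ge0 ?excess_ge0// lee_fin mulr_ge0.
- by apply: emeasurable_funD => //; exact: measurable_excess.
- exact: measurable_excess.
move=> w _; rewrite -EFinD lee_fin indicE.
have [/set_mem|/negP] := boolP (w \in _); rewrite ?inE/= in_itv/= andbT => h.
  have -> : Num.max (Y w - b) 0 = Y w - b by apply/max_idPl; rewrite subr_ge0 ltW.
  by rewrite mulr1 le_max addrA subrK lexx.
move/negP : h; rewrite -leNgt => h.
have -> : Num.max (Y w - b) 0 = 0 by apply/max_idPr; rewrite subr_le0.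
by rewrite mulr0 addr0 le_max lexx orbT.
Qed.

End StopLoss.

(** The [k] terms of weight [1 / (n + 1)] have total weight [grid R n k]. *)
Lemma sum_shift (R : realType) (f : nat -> R) n k A B :
  \sum_(i < k) (f i - B) / n.+1%:R =
  \sum_(i < k) (f i - A) / n.+1%:R + (A - B) * grid R n k.
Proof.
elim: k => [|k IH]; first by rewrite !big_ord0 grid0; ring.
by rewrite !big_ord_recr /= IH gridS; ring.
Qed.

(** * Quantiles of an almost surely bounded variable against its stop-loss transform *)

Section BoundedRV.
Context d (T : measurableType d) (R : realType) (P : probability T R).
Variables (Y : {RV P >-> R}) (m M : R).
Hypothesis Ybnd : \forall w \ae P, m <= Y w <= M.

Let F y : R := fine (cdf Y y).
Let FE y : cdf Y y = (F y)%:E. Proof. exact: cdf_fin. Qed.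

Let F_le x y : x <= y -> F x <= F y.
Proof. by move=> xy; rewrite -lee_fin -!FE cdf_nondecreasing. Qed.

Let F_ge0 y : 0 <= F y.
Proof. by rewrite -lee_fin -FE cdf_ge0. Qed.

Let F_le1 y : F y <= 1.
Proof. by rewrite -lee_fin -FE cdf_le1. Qed.

Lemma cdf_below y : y < m -> cdf Y y = 0%E.
Proof.
move=> ym; change (P (Y @^-1` `]-oo, y]) = 0%E); apply: measure_negligible.
  by rewrite -[X in measurable X]setTI; exact: measurable_funP.
apply: negligibleS Ybnd => w /=; rewrite in_itv/= => Yy /andP[mY _].
by have := le_lt_trans (le_trans mY Yy) ym; rewrite ltxx.
Qed.

Lemma cdf_above y : M <= y -> cdf Y y = 1%E.
Proof.
move=> My; have := cdf_ccdf_1 Y y.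
have -> : ccdf Y y = 0%E; last by rewrite adde0.
change (P (Y @^-1` `]y, +oo[) = 0%E); apply: measure_negligible.
  by rewrite -[X in measurable X]setTI; exact: measurable_funP.
apply: negligibleS Ybnd => w /=; rewrite in_itv/= andbT => Yy /andP[_ YM].
by have := lt_le_trans (le_lt_trans My Yy) YM; rewrite ltxx.
Qed.

(** One real-valued predicate for the two sets whose infima define [VaR]. *)
Definition reaches (s y : R) : Prop := if s == 0 then 0 < F y else s <= F y.

Lemma VaRE s : VaR Y s = inf [set y | reaches s y].
Proof.
rewrite /VaR /reaches; case: ifP => _; congr inf; apply/seteqP; split=> y /=;
by rewrite FE ?lte_fin ?lee_fin.
Qed.

Section Level.
Variable s : R.
Hypothesis s01 : 0 <= s <= 1.

Lemma reaches_ge y : reaches s y -> m <= y.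
Proof.
have /andP[s_ge0 _] := s01.
rewrite /reaches => h; rewrite leNgt; apply/negP => /cdf_below; rewrite FE => -[Fy0].
move: h; rewrite Fy0; case: ifPn => [_|s0]; first by rewrite ltxx.
by apply/negP; rewrite -ltNge lt_neqAle eq_sym s0.
Qed.

Lemma reaches_hi : reaches s M.
Proof.
have : (F M)%:E = 1%:E by rewrite -FE cdf_above.
by move=> -[]; rewrite /reaches => ->; case: ifP; rewrite ?ltr01//; case/andP: s01.
Qed.

Lemma VaR_le_of y : reaches s y -> VaR Y s <= y.
Proof.
move=> h; rewrite VaRE; apply: ge_inf => //.
by exists m => z /reaches_ge.
Qed.

Lemma VaR_ge_of c : (forall y, reaches s y -> c <= y) -> c <= VaR Y s.
Proof.
move=> h; rewrite VaRE; apply: lb_le_inf; last by move=> y; exact: h.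
by exists M; exact: reaches_hi.
Qed.

Lemma VaR_itv : m <= VaR Y s <= M.
Proof.
by rewrite VaR_le_of ?andbT; [apply: VaR_ge_of => y; exact: reaches_ge|exact: reaches_hi].
Qed.

Lemma reaches_homo x y : x <= y -> reaches s x -> reaches s y.
Proof.
move=> xy; rewrite /reaches; case: ifP => _ h; first exact: lt_le_trans h (F_le xy).
exact: le_trans h (F_le xy).
Qed.

(** The set [reaches s] is closed upwards, so it contains every point strictly above its infimum. *)
Lemma reaches_VaR_lt y : VaR Y s < y -> reaches s y.
Proof.
move=> h; apply: contrapT => ny.
suff : y <= VaR Y s by rewrite leNgt h.
apply: VaR_ge_of => z hz; rewrite leNgt; apply/negP => zy; apply: ny.
exact: reaches_homo (ltW zy) hz.
Qed.

Lemma cdf_gt_VaR y : VaR Y s < y -> s <= F y.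
Proof.
move=> /reaches_VaR_lt; rewrite /reaches; case: ifP => // /eqP ->; exact: ltW.
Qed.

Lemma cdf_lt_VaR y : y < VaR Y s -> F y <= s.
Proof.
move=> h; rewrite leNgt; apply/negP => sF.
suff : VaR Y s <= y by rewrite leNgt h.
apply: VaR_le_of; rewrite /reaches; case: ifP => [/eqP s0|_]; last exact: ltW.
by rewrite -s0.
Qed.

End Level.

(** At level [1] the condition is [1 <= F y], whose failure is a strict inequality; left continuity
    at level [1] rests on this strictness. *)
Lemma cdf_lt_VaR1 y : y < VaR Y 1 -> F y < 1.
Proof.
move=> h; rewrite ltNge; apply/negP => sF.
suff : VaR Y 1 <= y by rewrite leNgt h.
by apply: VaR_le_of; rewrite ?ler01 ?lexx// /reaches oner_eq0.
Qed.

Lemma VaR_homo s s' : 0 <= s -> s <= s' -> s' <= 1 -> VaR Y s <= VaR Y s'.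
Proof.
move=> s0 ss' s'1.
apply: VaR_ge_of => [|y]; first by rewrite (le_trans s0 ss').
move=> h; apply: VaR_le_of => //; first by rewrite s0 (le_trans ss').
move: h; rewrite /reaches; case: ifPn => [/eqP s'0|s'0].
  by rewrite ifT// eq_le s0 -s'0 ss'.
case: ifPn => [/eqP se0|_]; last exact: le_trans.
apply: lt_le_trans; rewrite lt_neqAle eq_sym s'0/=; exact: le_trans ss'.
Qed.

(** This is the continuity at [0] of the integrand [VaR Y (1 - t)] that [is_RSint_ex] asks for. The
    level [1 - t] is taken halfway between [F (VaR Y 1 - e)] and [1]. *)
Lemma VaR1_left_continuous (e : R) : 0 < e ->
  exists2 t : R, 0 < t <= 1 & VaR Y 1 - VaR Y (1 - t) <= e.
Proof.
move=> e0.
have Fy1 : F (VaR Y 1 - e) < 1 by apply: cdf_lt_VaR1; lra.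
have Fy0 := F_ge0 (VaR Y 1 - e).
pose t := (1 - F (VaR Y 1 - e)) / 2.
exists t; first by rewrite /t; apply/andP; split; lra.
rewrite lerBlDr -lerBlDl leNgt; apply/negP => h.
have := @cdf_gt_VaR (1 - t) _ _ h.
have -> : 0 <= 1 - t <= 1 by rewrite /t; apply/andP; split; lra.
move=> /(_ erefl); rewrite /t; lra.
Qed.

Lemma stop_loss_e_hi a : M <= a -> stop_loss_e Y a = 0%E.
Proof.
move=> Ma; apply/eqP; rewrite eq_le; apply/andP; split; last first.
  by apply: integral_ge0 => w _; exact: excess_ge0.
have <- : (\int[P]_(w in setT) (cst 0 w) = 0)%E by rewrite integral0.
apply: ae_ge0_le_integral => //.
- by move=> w _; exact: excess_ge0.
- exact: measurable_excess.
apply: filterS Ybnd => w /andP[_ YM] _.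
by rewrite lee_fin ge_max lexx andbT subr_le0 (le_trans YM).
Qed.

(** The transform is finite at [a] because it vanishes at [Num.max a M] and differs from that value
    by a finite amount. *)
Lemma stop_lossE a : stop_loss_e Y a = (stop_loss Y a)%:E.
Proof.
rewrite /stop_loss fineK// ge0_fin_numE; last first.
  by apply: integral_ge0 => w _; exact: excess_ge0.
have aM : a <= Num.max a M by rewrite le_max lexx.
apply: le_lt_trans (stop_loss_e_le Y aM) _.
by rewrite stop_loss_e_hi ?le_max ?lexx ?orbT// add0e ltry.
Qed.

Lemma stop_loss_hi a : M <= a -> stop_loss Y a = 0.
Proof. by move=> h; rewrite /stop_loss stop_loss_e_hi. Qed.

Lemma stop_loss_ge0 a : 0 <= stop_loss Y a.
Proof. by apply/fine_ge0/integral_ge0 => w _; exact: excess_ge0. Qed.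

Lemma stop_loss_le c b : c <= b ->
  stop_loss Y c <= stop_loss Y b + (b - c) * (1 - F c).
Proof. by move=> /(stop_loss_e_le Y); rewrite !stop_lossE -EFinD lee_fin. Qed.

Lemma stop_loss_ge c b : c <= b ->
  stop_loss Y b + (b - c) * (1 - F b) <= stop_loss Y c.
Proof. by move=> /(stop_loss_e_ge Y); rewrite !stop_lossE -EFinD lee_fin. Qed.

Lemma stop_loss_le1 c b : c <= b -> stop_loss Y c <= stop_loss Y b + (b - c).
Proof.
move=> cb; apply: le_trans (stop_loss_le cb) _; rewrite lerD2l.
by rewrite ler_piMr ?subr_ge0//; have := F_ge0 c; lra.
Qed.

Lemma stop_loss_anti c b : c <= b -> stop_loss Y b <= stop_loss Y c.
Proof.
move=> cb; apply: le_trans (stop_loss_ge cb); rewrite lerDl.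
by rewrite mulr_ge0 ?subr_ge0.
Qed.

(* [s <= F y] is only known strictly to the right of the quantile, so the bound
   is first proved from [c > a] and [c] then tends to [a]. *)
Lemma stop_loss_le_VaR s a b : 0 <= s <= 1 -> VaR Y s <= a -> a <= b ->
  stop_loss Y a <= stop_loss Y b + (b - a) * (1 - s).
Proof.
move=> s01 va ab; apply/ler_addgt0Pr => e e0.
have [->|nab] := eqVneq a b; first by rewrite subrr mul0r addr0 lerDl ltW.
have {}ab : a < b by rewrite lt_neqAle nab.
pose c := Num.min (a + e) b.
have ac : a < c by rewrite lt_min ab ltrDl e0.
have cb : c <= b by rewrite ge_min lexx orbT.
have cae : c <= a + e by rewrite ge_min lexx.
have h1 := stop_loss_le1 (ltW ac).
have h2 := stop_loss_le cb.
have sF := cdf_gt_VaR s01 (le_lt_trans va ac).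
have : (b - c) * (1 - F c) <= (b - c) * (1 - s).
  by rewrite ler_wpM2l ?subr_ge0// lerB.
have : (c - a) * s <= e by case/andP: s01 => s0 s1; nra.
lra.
Qed.

(** Mirror argument: [F c <= s] is known for [c] strictly to the left of the quantile, and [c] tends
    to [b]. *)
Lemma stop_loss_ge_VaR s a b : 0 <= s <= 1 -> a <= b -> b <= VaR Y s ->
  stop_loss Y b + (b - a) * (1 - s) <= stop_loss Y a.
Proof.
move=> s01 ab bv; apply/ler_addgt0Pr => e e0.
have [->|nab] := eqVneq a b; first by rewrite subrr mul0r addr0 lerDl ltW.
have {}ab : a < b by rewrite lt_neqAle nab.
pose c := Num.max a (b - e).
have ac : a <= c by rewrite le_max lexx.
have cb : c < b by rewrite gt_max ab ltrBlDr ltrDl e0.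
have cbe : b - e <= c by rewrite le_max lexx orbT.
have h1 := stop_loss_anti (ltW cb).
have h2 := stop_loss_ge ac.
have sF := cdf_lt_VaR s01 (lt_le_trans cb bv).
have : (c - a) * (1 - s) <= (c - a) * (1 - F c).
  by rewrite ler_wpM2l ?subr_ge0// lerB.
have : (b - c) * (1 - s) <= e by case/andP: s01 => s0 s1; nra.
lra.
Qed.

Let g t := VaR Y (1 - t).

Let compl01 (t : R) : 0 <= t <= 1 -> 0 <= 1 - t <= 1.
Proof. by move=> /andP[? ?]; apply/andP; split; lra. Qed.

Lemma VaR_compl_anti x y : 0 <= x -> x <= y -> y <= 1 -> g y <= g x.
Proof. by move=> *; apply: VaR_homo; lra. Qed.

Let grid_anti n i j : (i <= j)%N -> (j <= n.+1)%N -> g (grid R n j) <= g (grid R n i).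
Proof.
move=> ij jn; have /andP[? _] := grid01 R (leq_trans ij jn).
have /andP[_ ?] := grid01 R jn.
by apply: VaR_compl_anti => //; exact: grid_le.
Qed.

(** The transform vanishes at [VaR Y 1]. From one grid quantile down to the next, of index [k.+1],
    it grows by at most the gap times [(k + 1) / (n + 1)], and [sum_shift] absorbs this growth into
    the sum. *)
Lemma stop_loss_upper n k : (k <= n.+1)%N ->
  stop_loss Y (g (grid R n k)) <= \sum_(i < k) (g (grid R n i) - g (grid R n k)) / n.+1%:R.
Proof.
elim: k => [_|k IH kn].
  rewrite big_ord0 grid0 /g subr0.
  have v1 : VaR Y 1 <= M by case/andP: (@VaR_itv 1 ltac:(by rewrite ler01 lexx)).
  have := @stop_loss_le_VaR 1 _ _ ltac:(by rewrite ler01 lexx) (lexx _) v1.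
  by rewrite (stop_loss_hi (lexx M)) subrr mulr0 addr0.
have k01 := compl01 (grid01 R kn).
have gk := grid_anti (leqnSn k) kn.
have := stop_loss_le_VaR k01 (lexx _) gk.
rewrite -/(g _) subKr => /le_trans; apply.
apply: le_trans (lerD (IH (ltnW kn)) (lexx _)) _.
rewrite big_ord_recr /=.
set A := g (grid R n k); set B := g (grid R n k.+1).
by rewrite (sum_shift (fun i => g (grid R n i)) _ _ A B) gridS mulrDr addrA.
Qed.

(** The case where [a] is the grid quantile of index [k] is the induction of [stop_loss_upper] with
    the reverse bound. Any other [a] follows because the line of slope [- k / (n + 1)] through that
    point of the graph lies below the transform on both sides. *)
Lemma stop_loss_lower n k a : (k <= n.+1)%N ->
  \sum_(i < k) (g (grid R n i.+1) - a) / n.+1%:R <= stop_loss Y a.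
Proof.
move=> kn; have k01 := compl01 (grid01 R kn).
have at_quantile : \sum_(i < k) (g (grid R n i.+1) - g (grid R n k)) / n.+1%:R <=
    stop_loss Y (g (grid R n k)).
  elim: k kn k01 => [_ _|k IH kn _]; first by rewrite big_ord0 stop_loss_ge0.
  have k01 := compl01 (grid01 R (ltnW kn)).
  have gk := grid_anti (leqnSn k) kn.
  have := stop_loss_ge_VaR k01 gk (lexx _).
  rewrite subKr; apply: le_trans.
  apply: le_trans _ (lerD (IH (ltnW kn) k01) (lexx _)).
  rewrite big_ord_recr /= subrr mul0r addr0.
  by rewrite (sum_shift (fun i => g (grid R n i.+1)) _ _ (g (grid R n k)) _).
rewrite (sum_shift (fun i => g (grid R n i.+1)) _ _ (g (grid R n k)) _).
have [ag|ga] := leP a (g (grid R n k)).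
  have := stop_loss_ge_VaR k01 ag (lexx _); rewrite subKr; lra.
have := stop_loss_le_VaR k01 (lexx _) (ltW ga); rewrite subKr -/(g _); lra.
Qed.

End BoundedRV.

(** * Distortion risk measures *)

Lemma cvg_sumr (R : realType) (I : Type) (r : seq I) (f : I -> nat -> R) (l : I -> R) :
  (forall i, f i @ \oo --> l i) ->
  (fun n => \sum_(i <- r) f i n) @ \oo --> \sum_(i <- r) l i.
Proof.
move=> fl; elim: r => [|i r IH].
  by rewrite big_nil; under eq_fun do rewrite big_nil; exact: cvg_cst.
rewrite big_cons; under eq_fun do rewrite big_cons.
exact: cvgD (fl i) IH.
Qed.

Section Rho.
Context d (T : measurableType d) (R : realType) (P : probability T R).
Variable Q : R -> R.
Hypotheses (BQ : BUM Q) (cQ : concave_on01 Q).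
Implicit Type Y : {RV P >-> R}.

Definition ae_bounded Y (m M : R) := \forall w \ae P, m <= Y w <= M.

(** Existence of the integral rules out the default value of [xget]; any tags in the grid cells then
    compute [rho]. *)
Lemma rho_grid_cvg Y m M (xi : nat -> nat -> R) : ae_bounded Y m M ->
  (forall n i, (i <= n)%N -> grid R n i <= xi n i <= grid R n i.+1) ->
  (fun n => \sum_(i < n.+1) VaR Y (1 - xi n i) * (Q (grid R n i.+1) - Q (grid R n i)))
    @ \oo --> rho Q Y.
Proof.
move=> Yb; apply: (@is_RSint_grid R (fun t => VaR Y (1 - t))).
rewrite /rho /RSint; apply: (@xgetPex _ 0 (is_RSint 0 1 (fun t => VaR Y (1 - t)) Q)).
apply: is_RSint_ex => // [x y x0 xy y1|e e0]; first exact: (VaR_compl_anti Yb).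
by rewrite subr0; exact: (VaR1_left_continuous Yb).
Qed.

Lemma rho_left_cvg Y m M : ae_bounded Y m M ->
  (fun n => \sum_(i < n.+1) VaR Y (1 - grid R n i) * (Q (grid R n i.+1) - Q (grid R n i)))
    @ \oo --> rho Q Y.
Proof.
move=> Yb; apply: (rho_grid_cvg Yb) => n i _.
by rewrite lexx ltW ?grid_lt.
Qed.

Lemma rho_right_cvg Y m M : ae_bounded Y m M ->
  (fun n => \sum_(i < n.+1) VaR Y (1 - grid R n i.+1) * (Q (grid R n i.+1) - Q (grid R n i)))
    @ \oo --> rho Q Y.
Proof.
move=> Yb; apply: (rho_grid_cvg (xi := fun n i => grid R n i.+1) Yb) => n i _.
by rewrite lexx andbT ltW ?grid_lt.
Qed.

(** As [Y] is almost surely nonnegative, [stop_loss Y 0] is its mean, in which all quantiles weigh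
    the same, whereas [Q t >= t] makes [rho] favour the large ones. *)
Lemma stop_loss0_le_rho Y m M : ae_bounded Y m M -> 0 <= m -> stop_loss Y 0 <= rho Q Y.
Proof.
move=> Yb m0.
apply: (@ler_cvg_to _ \oo _ _ (cst (stop_loss Y 0)) _ _ _ _ (rho_left_cvg Yb)).
  exact: cvg_cst.
apply: nearW => n.
set g := fun i => VaR Y (1 - grid R n i).
have gN0 : 0 <= g n.+1.
  rewrite /g grid1 subrr (le_trans m0)//.
  by case/andP: (VaR_itv Yb (s := 0) ltac:(by rewrite lexx ler01)).
have up := stop_loss_upper Yb (leqnn n.+1).
(* Going down from the least quantile [g n.+1] to [0] costs [g n.+1], which cancels the shift in the
   sum of [up]. *)
have := stop_loss_le1 Yb gN0.
rewrite subr0 => /le_trans; apply.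
apply: le_trans (lerD up (lexx _)) _.
rewrite -/(g _) (sum_shift g _ _ 0 (g n.+1)) grid1 mulr1 sub0r addrNK.
have -> : \sum_(i < n.+1) (g i - 0) / n.+1%:R = \sum_(i < n.+1) n.+1%:R^-1 * g i.
  by apply: eq_bigr => i _; rewrite subr0 mulrC.
under [leRHS]eq_bigr do rewrite mulrC.
(* The quantiles are the nonincreasing factor here; the partial sums of the weights are
   [k / (n + 1)] and [Q (k / (n + 1))]. *)
apply: (@ler_abel_sum R g (fun=> n.+1%:R^-1) (fun i => Q (grid R n i.+1) - Q (grid R n i))).
- move=> i ltin; apply: (VaR_compl_anti Yb); last 1 first.
  + by case/andP: (@grid01 R n i.+1 (leqW ltin)).
  + by case/andP: (@grid01 R n i (ltnW (leqW ltin))).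
  + exact: grid_le.
- apply: le_trans gN0 _; apply: (VaR_compl_anti Yb); last 1 first.
  + by rewrite grid1.
  + by case/andP: (@grid01 R n n (leqnSn n)).
  + exact: grid_le.
move=> k kn.
rewrite -(big_mkord xpredT (fun i => Q (grid R n i.+1) - Q (grid R n i))).
rewrite telescope_sumr// sumr_const card_ord grid0.
case: (BQ) => _ -> _ _; rewrite subr0 -[X in X <= _]mulr_natl.
apply: concave_ge_id => //; exact: grid01.
Qed.

(** * Nonnegative combinations of bounded variables *)

Section Combination.
Variables (k : nat) (x : 'I_k -> R) (C : 'I_k -> {RV P >-> R}) (Y : {RV P >-> R}).
Variables (m M : 'I_k -> R).
Hypotheses (x0 : forall j, 0 <= x j) (Cb : forall j, ae_bounded (C j) (m j) (M j)).
Hypothesis YE : forall w, Y w = \sum_j x j * C j w.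

Lemma ae_bounded_all : \forall w \ae P, forall j, m j <= C j w <= M j.
Proof. by apply: filter_forall => j; exact: Cb. Qed.

Lemma ae_bounded_comb : ae_bounded Y (\sum_j x j * m j) (\sum_j x j * M j).
Proof.
apply: filterS ae_bounded_all => w h.
rewrite YE; apply/andP; split; apply: ler_sum => j _;
by rewrite ler_wpM2l//; case/andP: (h j).
Qed.

Lemma scaled_stop_lossE (a : 'I_k -> R) :
  (\sum_j x j * stop_loss (C j) (a j))%:E =
  (\int[P]_w (\sum_j x j * Num.max (C j w - a j) 0)%:E)%E.
Proof.
under eq_integral do rewrite -sumEFin.
rewrite ge0_integral_sum//.
- rewrite -sumEFin; apply: eq_bigr => j _.
  rewrite EFinM -(stop_lossE (Cb j)) /stop_loss_e -ge0_integralZl_EFin//.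
  + by move=> w _; exact: excess_ge0.
  + exact: measurable_excess.
- move=> j; apply/measurable_EFinP; apply: measurable_funM => //.
  by apply/measurable_EFinP; exact: measurable_excess.
- by move=> j w _; rewrite lee_fin mulr_ge0// le_max lexx orbT.
Qed.

Lemma measurable_scaled_excess (a : 'I_k -> R) :
  measurable_fun setT (fun w => (\sum_j x j * Num.max (C j w - a j) 0)%:E).
Proof.
apply/measurable_EFinP; apply: measurable_sum => j.
by apply: measurable_funM => //; apply/measurable_EFinP; exact: measurable_excess.
Qed.

(** Pointwise, the positive part of a sum is at most the sum of the positive parts. *)
Lemma stop_loss_comb_le (a : 'I_k -> R) :
  stop_loss Y (\sum_j x j * a j) <= \sum_j x j * stop_loss (C j) (a j).
Proof.
rewrite -lee_fin scaled_stop_lossE -(stop_lossE ae_bounded_comb).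
apply: ge0_le_integral => //.
- by move=> w _; exact: excess_ge0.
- exact: measurable_excess.
- exact: measurable_scaled_excess.
move=> w _; rewrite lee_fin ge_max; apply/andP; split.
  rewrite YE -sumrB; apply: ler_sum => j _.
  by rewrite -mulrBr ler_wpM2l// le_max lexx.
by apply: sumr_ge0 => j _; rewrite mulr_ge0// le_max lexx orbT.
Qed.

(** Every [C j] is almost surely nonnegative, so the positive parts at [0] disappear and both
    integrands are [Y]. *)
Lemma stop_loss_comb_ge : (forall j, 0 <= m j) ->
  \sum_j x j * stop_loss (C j) 0 <= stop_loss Y 0.
Proof.
move=> m0; rewrite -lee_fin (scaled_stop_lossE (fun=> 0)) -(stop_lossE ae_bounded_comb).
apply: ae_ge0_le_integral => //.
- move=> w _; rewrite lee_fin; apply: sumr_ge0 => j _.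
  by rewrite mulr_ge0// le_max lexx orbT.
- exact: measurable_scaled_excess.
- by move=> w _; exact: excess_ge0.
- exact: measurable_excess.
apply: filterS ae_bounded_all => w h _.
rewrite lee_fin le_max YE subr0; apply/orP; left; apply: ler_sum => j _.
have /andP[h0 _] := h j.
by rewrite ler_wpM2l// ge_max subr0 lexx (le_trans (m0 j)).
Qed.

(** Right-tagged sums for [Y] are compared with left-tagged sums for the [C j], which are the tags
    of [stop_loss_lower] and [stop_loss_upper]; both kinds converge to [rho]. *)
Lemma rho_subadditive : rho Q Y <= \sum_j x j * rho Q (C j).
Proof.
have Yb := ae_bounded_comb.
pose U n j := \sum_(i < n.+1) VaR (C j) (1 - grid R n i) * (Q (grid R n i.+1) - Q (grid R n i)).
have Ucvg : (fun n => \sum_j x j * U n j) @ \oo --> \sum_j x j * rho Q (C j).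
  apply: cvg_sumr => j; apply: cvgMl_tmp; exact: (rho_left_cvg (Cb j)).
apply: (ler_cvg_to (rho_right_cvg Yb) Ucvg); apply: nearW => n.
pose D i := Q (grid R n i.+1) - Q (grid R n i).
have -> : \sum_j x j * U n j =
    \sum_(i < n.+1) (\sum_j x j * VaR (C j) (1 - grid R n i)) * D i.
  rewrite /U; under eq_bigr do rewrite mulr_sumr.
  rewrite exchange_big /=; apply: eq_bigr => i _.
  by rewrite mulr_suml; apply: eq_bigr => j _; rewrite mulrA.
(* Now the increments of [Q] are the nonincreasing factor, and partial sums of quantiles remain to
   be compared. *)
apply: (@ler_abel_sum R D (fun i => VaR Y (1 - grid R n i.+1))
  (fun i => \sum_j x j * VaR (C j) (1 - grid R n i))).
- move=> i ltin; rewrite /D.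
  have /andP[i0 _] := @grid01 R n i (ltnW (leqW ltin)).
  have /andP[_] := @grid01 R n i.+2 ltin.
  rewrite (gridS R n i.+1) (gridS R n i) => i2.
  by apply: concave_increments.
- rewrite /D subr_ge0; apply: BUM_homo => //.
  + by case/andP: (@grid01 R n n (leqnSn n)).
  + exact: grid_le.
  + by rewrite grid1.
move=> l ln.
(* At these quantiles [stop_loss_upper] applies to each [C j]. Their combination need not be a
   quantile of [Y], whence the free point in [stop_loss_lower]. The terms
   [(\sum_j x j * a j) * grid R n l] finally cancel. *)
pose a j := VaR (C j) (1 - grid R n l).
have lo := stop_loss_lower Yb (\sum_j x j * a j) ln.
have mid := stop_loss_comb_le a.
have up : \sum_j x j * stop_loss (C j) (a j) <=
    \sum_j x j * (\sum_(i < l) (VaR (C j) (1 - grid R n i) - a j) / n.+1%:R).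
  by apply: ler_sum => j _; rewrite ler_wpM2l//; exact: (stop_loss_upper (Cb j) ln).
have := le_trans lo (le_trans mid up).
have -> : \sum_(i < l) (VaR Y (1 - grid R n i.+1) - \sum_j x j * a j) / n.+1%:R =
    (\sum_(i < l) VaR Y (1 - grid R n i.+1)) / n.+1%:R - (\sum_j x j * a j) * grid R n l.
  rewrite (sum_shift (fun i => VaR Y (1 - grid R n i.+1)) _ _ 0) sub0r mulNr.
  by congr (_ - _); rewrite mulr_suml; apply: eq_bigr => i _; rewrite subr0.
have -> : \sum_j x j * (\sum_(i < l) (VaR (C j) (1 - grid R n i) - a j) / n.+1%:R) =
    (\sum_(i < l) \sum_j x j * VaR (C j) (1 - grid R n i)) / n.+1%:R
    - (\sum_j x j * a j) * grid R n l.
  rewrite exchange_big /= !mulr_suml -sumrB; apply: eq_bigr => j _.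
  rewrite (sum_shift (fun i => VaR (C j) (1 - grid R n i)) _ _ 0) sub0r mulrDr mulNr mulrN mulrA.
  congr (_ - _); rewrite mulr_sumr mulr_suml; apply: eq_bigr => i _.
  by rewrite subr0 mulrA.
by rewrite lerD2r ler_pM2r ?invr_gt0.
Qed.

End Combination.
End Rho.

(** * Uniform laws *)

Section Uniform.
Context d (T : measurableType d) (R : realType) (P : probability T R).
Variables (a b : R) (X : {RV P >-> R}).
Hypothesis uX : uniform_on a b X.

Lemma uniform_le : a <= b. Proof. by case: uX. Qed.

Lemma uniform_ae_bounded : ae_bounded X a b.
Proof.
have [ab unif dirac] := uX.
have mX : measurable (X @^-1` ~` `[a, b]).
  by rewrite -[X in measurable X]setTI; apply: measurable_funP => //; exact: measurableC.
have X0 : P (X @^-1` ~` `[a, b]) = 0%E.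
  change (distribution P X (~` `[a, b]) = 0%E).
  move: ab; rewrite le_eqVlt => /predU1P[ab|ab].
    rewrite dirac//; last exact: measurableC.
    by rewrite diracE memNset// => /=; rewrite in_itv/= lexx -ab lexx.
  rewrite (unif ab)//; last exact: measurableC.
  by rewrite /uniform_prob integral_uniform_pdf setICl integral_set0.
by exists (X @^-1` ~` `[a, b]); split.
Qed.

Lemma uniform_cdf y : a < b -> a <= y <= b -> fine (cdf X y) = (y - a) / (b - a).
Proof.
move=> ab /andP[ay yb]; have [_ /(_ ab) unif _] := uX.
rewrite /cdf unif// /uniform_prob integral_uniform_pdf.
have -> : `]-oo, y] `&` `[a, b] = `[a, y]%classic.
  apply/seteqP; split=> z /=; rewrite !in_itv/=.
    by move=> [-> /andP[-> _]].
  by move=> /andP[-> zy]; rewrite zy (le_trans zy yb).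
rewrite (eq_integral (fun=> ((b - a)^-1)%:E)); last first.
  move=> z; rewrite inE/= in_itv/= => /andP[az zy].
  by rewrite /uniform_pdf az (le_trans zy yb).
rewrite integral_cst//=.
rewrite lebesgue_measure_itv/= lte_fin.
case: ifPn => [_|]; first by rewrite -EFinD -EFinM /= mulrC.
rewrite -leNgt => ya; have -> : y = a by apply/eqP; rewrite eq_le ya.
by rewrite subrr mul0r mule0.
Qed.

(** If the two sides differed, the affine distribution function at their midpoint would contradict
    [cdf_gt_VaR] or [cdf_lt_VaR]. *)
Lemma uniform_VaR s : 0 <= s <= 1 -> VaR X s = a + s * (b - a).
Proof.
move=> s01; have /andP[av vb] := VaR_itv uniform_ae_bounded s01.
have /andP[s0 s1] := s01.
have := uniform_le; rewrite le_eqVlt => /predU1P[ab|ab].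
  by apply/eqP; rewrite -ab subrr mulr0 addr0 eq_le av andbT ab.
have ba0 : 0 < b - a by rewrite subr_gt0.
have [vw|wv|//] := ltgtP (VaR X s) (a + s * (b - a)).
- pose y := (VaR X s + (a + s * (b - a))) / 2.
  have vy : VaR X s < y by rewrite /y; lra.
  have := cdf_gt_VaR uniform_ae_bounded s01 vy.
  have yb : y <= b by rewrite /y; nra.
  rewrite uniform_cdf// ?yb ?andbT; last by rewrite (le_trans av)// ltW.
  rewrite ler_pdivlMr// /y; lra.
- pose y := (VaR X s + (a + s * (b - a))) / 2.
  have yv : y < VaR X s by rewrite /y; lra.
  have := cdf_lt_VaR uniform_ae_bounded s01 yv.
  have ya : a <= y by rewrite /y; nra.
  rewrite uniform_cdf// ?ya //=; last by rewrite (le_trans _ vb)// ltW.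
  rewrite ler_pdivrMr// /y; lra.
Qed.

Let inv_cvg0 : (fun n : nat => n.+1%:R^-1 : R) @ \oo --> (0 : R).
Proof. exact: cvg_harmonic. Qed.

Lemma rho_uniform (Q : R -> R) : BUM Q -> concave_on01 Q ->
  rho Q X = a + (b - a) * int01 Q.
Proof.
move=> BQ cQ.
pose I n := \sum_(i < n.+1) Q (grid R n i) / n.+1%:R.
(* Since [VaR X (1 - t) = b - (b - a) * t], summation by parts moves the differences from [Q] to the
   grid. The extra [1 / (n + 1)] comes from the last left tag, [1 - 1 / (n + 1)]. *)
have E n : \sum_(i < n.+1) VaR X (1 - grid R n i) * (Q (grid R n i.+1) - Q (grid R n i)) =
    a + (b - a) * (n.+1%:R^-1 + I n).
  have [_ Q0 Q1 _] := BQ.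
  have ibp := abel_sum (grid R n) (fun i => Q (grid R n i)) n.
  rewrite grid0 mulr0 subr0 grid1 Q1 mul1r in ibp.
  have gn : grid R n n = 1 - n.+1%:R^-1 by apply/esym/eqP; rewrite subr_eq -gridS grid1.
  have In : I n = - \sum_(i < n) Q (grid R n i.+1) * (grid R n i - grid R n i.+1).
    rewrite /I big_ord_recl /= grid0 Q0 mul0r add0r -sumrN.
    by apply: eq_bigr => i _; rewrite /= /bump/= add1n gridS opprD addrA subrr sub0r mulrN opprK.
  have tel : \sum_(i < n.+1) (Q (grid R n i.+1) - Q (grid R n i)) = 1.
    rewrite -(big_mkord xpredT (fun i => Q (grid R n i.+1) - Q (grid R n i))).
    by rewrite telescope_sumr// grid1 grid0 Q0 Q1 subr0.
  transitivity (b * \sum_(i < n.+1) (Q (grid R n i.+1) - Q (grid R n i)) -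
     (b - a) * \sum_(i < n.+1) (Q (grid R n i.+1) - Q (grid R n i)) * grid R n i).
    rewrite !mulr_sumr -sumrB; apply: eq_bigr => i _.
    rewrite uniform_VaR; first by ring.
    have /andP[? ?] := @grid01 R n i (ltnW (ltn_ord i)).
    by apply/andP; split; lra.
  by rewrite tel ibp gn In; ring.
have c : (fun n => a + (b - a) * (n.+1%:R^-1 + I n)) @ \oo --> a + (b - a) * int01 Q.
  apply: cvgD; first exact: cvg_cst.
  apply: cvgMl_tmp; rewrite -[int01 Q]add0r; apply: cvgD => //.
  exact: int01_grid.
have := rho_left_cvg BQ cQ uniform_ae_bounded.
under eq_fun do rewrite E.
by move=> /cvg_unique; apply.
Qed.

Lemma grid_mean n : \sum_(i < n.+1) grid R n i / n.+1%:R = (1 - n.+1%:R^-1) / 2.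
Proof.
have H k : \sum_(i < k) grid R n i = grid R n k * (k%:R - 1) / 2.
  elim: k => [|k IH]; first by rewrite big_ord0 grid0 !mul0r.
  rewrite big_ord_recr /= IH gridS /grid -natr1; field; rewrite gt_eqF//.
rewrite -mulr_suml H grid1 mul1r; field; rewrite gt_eqF//.
Qed.

(** The transform at [0] is at least the average of the grid quantiles, which tends to
    [(a + b) / 2]. *)
Lemma uniform_mean : a + b <= 2 * stop_loss X 0.
Proof.
have c : (fun n : nat => a + b - (b - a) * n.+1%:R^-1) @ \oo --> a + b - (b - a) * 0.
  by apply: cvgB; [exact: cvg_cst|exact: cvgMl_tmp].
rewrite mulr0 subr0 in c.
apply: (ler_cvg_to c (cvg_cst _)); apply: nearW => n.
have := stop_loss_lower uniform_ae_bounded 0 (leqnn n.+1).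
have -> : \sum_(i < n.+1) (VaR X (1 - grid R n i.+1) - 0) / n.+1%:R =
    b - (b - a) * (n.+1%:R^-1 + \sum_(i < n.+1) grid R n i / n.+1%:R).
  have -> : b - (b - a) * (n.+1%:R^-1 + \sum_(i < n.+1) grid R n i / n.+1%:R) =
    \sum_(i < n.+1) (b / n.+1%:R - (b - a) * (n.+1%:R^-1 / n.+1%:R + grid R n i / n.+1%:R)).
    rewrite sumrB; congr (_ - _).
      by rewrite sumr_const card_ord -[RHS]mulr_natr divfK.
    rewrite -mulr_sumr big_split /=; congr (_ * (_ + _)).
    by rewrite sumr_const card_ord -[RHS]mulr_natr divfK.
  apply: eq_bigr => i _; rewrite subr0 uniform_VaR; first by rewrite gridS; ring.
  have /andP[? ?] := @grid01 R n i.+1 (ltn_ord i).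
  by apply/andP; split; lra.
rewrite grid_mean; set v := n.+1%:R^-1; lra.
Qed.

End Uniform.

(** By [Q t >= t], the grid sums of [Q] dominate those of the identity, which tend to [1 / 2]. *)
Lemma int01_ge_half (R : realType) (Q : R -> R) : BUM Q -> concave_on01 Q -> 1 <= 2 * int01 Q.
Proof.
move=> BQ cQ.
have c : (fun n : nat => 1 - n.+1%:R^-1 : R) @ \oo --> (1 - 0 : R).
  by apply: cvgB; [exact: cvg_cst|exact: cvg_harmonic].
rewrite subr0 in c.
have c2 : (fun n => 2 * \sum_(i < n.+1) Q (grid R n i) / n.+1%:R) @ \oo --> 2 * int01 Q.
  by apply: cvgMl_tmp; exact: int01_grid.
apply: (ler_cvg_to c c2); apply: nearW => n.
have -> : 1 - n.+1%:R^-1 = 2 * \sum_(i < n.+1) grid R n i / n.+1%:R.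
  by rewrite grid_mean mulrC divfK.
rewrite ler_pM2l//; apply: ler_sum => i _.
rewrite ler_pM2r ?invr_gt0//; apply: concave_ge_id => //.
exact: grid01 (ltnW (ltn_ord i)).
Qed.

(** * Polynomial time *)

Lemma abs_lt_bits (z : int) : (`|z| < 2 ^ dsize (DInt z))%N.
Proof. exact: trunc_log_ltn. Qed.

Lemma bits_le (z : int) n : (0 < n)%N -> (`|z| < 2 ^ n)%N -> (dsize (DInt z) <= n)%N.
Proof.
move=> n0 zn /=; case: (posnP `|z|%N) => [->|z0]; first by rewrite trunc_log0.
by rewrite -(ltn_exp2l (m := 2))// (leq_ltn_trans _ zn)// trunc_logP.
Qed.

(** The node of the pair counts for one in the size, which pays for the carry. *)
Lemma abs_lt_pair (x y : int) :
  (`|x| + `|y| < 2 ^ dsize (DPair (DInt x) (DInt y)))%N.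
Proof.
have hx := abs_lt_bits x; have hy := abs_lt_bits y.
rewrite [dsize (DPair _ _)]/= expnS mul2n -addnn.
rewrite -addSn; apply: leq_add.
  by apply: leq_trans hx _; rewrite leq_exp2l// leq_addr.
by apply: leq_trans (ltnW hy) _; rewrite leq_exp2l// leq_addl.
Qed.

Lemma dsize_gt0 v : (0 < dsize v)%N. Proof. by case: v. Qed.

(* [PDiv] is left out only to avoid a bound on the size of quotients. *)
Fixpoint straight (p : prog) : bool :=
  match p with
  | Prim PDiv => false
  | Prim _ => true
  | Seq p q | Fork p q => straight p && straight q
  | If _ _ _ | While _ _ => false
  end.

(** The value on [If] and [While] is a placeholder: execution is related to [run] under [straight]
    only. *)
Fixpoint run (p : prog) (v : data) : data :=
  match p with
  | Prim o => prim_fun o v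
  | Seq p q => run q (run p v)
  | Fork p q => DPair (run p v) (run q v)
  | If _ _ _ | While _ _ => v
  end.

Lemma prim_fun_size o : straight (Prim o) ->
  exists k, forall v, (dsize (prim_fun o v) <= k * dsize v)%N.
Proof.
case: o => //= [|c|||||||] _.
- by exists 1%N => v; rewrite mul1n.
- by exists (dsize c) => v; rewrite leq_pmulr// dsize_gt0.
- exists 1%N => -[z|a b] /=; rewrite mul1n//; lia.
- exists 1%N => -[z|a b] /=; rewrite mul1n//; lia.
- by exists 1%N => -[z|a b].
- exists 1%N => -[z|[x|? ?] [y|? ?]] //=; rewrite ?mul1n //; by case: (x <= y).
- exists 1%N => -[z|[x|a b] [y|c e]]; rewrite mul1n; try exact: dsize_gt0.
  apply: bits_le; first by rewrite dsize_gt0.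
  by apply: leq_ltn_trans (abs_lt_pair x y); lia.
- exists 1%N => -[z|[x|a b] [y|c e]]; rewrite mul1n; try exact: dsize_gt0.
  apply: bits_le; first by rewrite dsize_gt0.
  by apply: leq_ltn_trans (abs_lt_pair x y); lia.
- exists 1%N => -[z|[x|a b] [y|c e]]; rewrite mul1n; try exact: dsize_gt0.
  apply: bits_le; first by rewrite dsize_gt0.
  rewrite abszM /=; apply: leq_trans (_ : 2 ^ (dsize (DInt x) + dsize (DInt y)) <= _)%N.
    by rewrite expnD ltn_mul ?abs_lt_bits.
  by rewrite leq_exp2l.
Qed.

Lemma exec_output_le p v w t : exec p v w t -> (dsize w <= t)%N.
Proof. elim=> {p v w t} *; lia. Qed.

(** Writing the output is charged, so sizes are bounded by costs, and without loops the linear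
    bounds compose to a linear bound. *)
Lemma straight_exec p : straight p ->
  exists k, forall v, exists2 t, exec p v (run p v) t & (t <= k * dsize v)%N.
Proof.
elim: p => [op|p IHp q IHq|p IHp q IHq|//|//].
- move=> /prim_fun_size[k kP]; exists k.+1 => v.
  by eexists; [exact: EPrim|rewrite mulSn leq_add2l].
- move=> /= /andP[/IHp[k kP] /IHq[l lP]]; exists (k + l * k + 1)%N => v.
  have [t1 e1 t1k] := kP v; have [t2 e2 t2l] := lP (run p v).
  exists (t1 + t2).+1; first exact: ESeq e1 e2.
  have := exec_output_le e1; have := dsize_gt0 v.
  nia.
- move=> /= /andP[/IHp[k kP] /IHq[l lP]]; exists (2 * k + 2 * l + 2)%N => v.
  have [t1 e1 t1k] := kP v; have [t2 e2 t2l] := lP v.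
  eexists; first exact: EFork e1 e2.
  have := exec_output_le e1; have := exec_output_le e2; have := dsize_gt0 v; rewrite /=; lia.
Qed.

Lemma horner_nat_le (q : {poly nat}) m n : (m <= n)%N -> (q.[m] <= q.[n])%N.
Proof.
move=> mn; rewrite !horner_coef; elim/big_ind2: _ => // [a b c e ab ce|i _].
  exact: leq_add.
apply: leq_mul => //; elim: (val i) => [|k IH]; first by rewrite !expr0.
by rewrite !exprS; apply: leq_mul.
Qed.

(** * Closure properties of polynomial time *)

Section Polytime.
Variables (A B : Type) (D : A -> Prop) (D' : B -> Prop).

(** The intermediate result is no larger than the first cost, so the second cost is bounded by [q']
    composed with [q]. The second problem may have instances of another type, chosen by the last
    hypothesis. *)
Lemma polytime_seq (i m o : A -> data -> Prop) (i' o' : B -> data -> Prop) :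
  polytime D i m -> polytime D' i' o' ->
  (forall a u, D a -> m a u -> exists b, [/\ D' b, i' b u & forall w, o' b w -> o a w]) ->
  polytime D i o.
Proof.
move=> [p [q pP]] [p' [q' p'P]] glue.
exists (Seq p p'), (q + (q' \Po q) + 1) => a v Da iav.
have [u [t1 [e1 t1q mau]]] := pP a v Da iav.
have [b [Db ibu ow]] := glue a u Da mau.
have [w [t2 [e2 t2q obw]]] := p'P b u Db ibu.
exists w, (t1 + t2).+1; split; [exact: ESeq e1 e2| |exact: ow].
have -> : (q + (q' \Po q) + 1).[dsize v] = (q.[dsize v] + q'.[q.[dsize v]] + 1)%N.
  by rewrite !hornerD horner_comp hornerC.
have := horner_nat_le q' (leq_trans (exec_output_le e1) t1q).
lia.
Qed.

Lemma polytime_fork (i o1 o2 : A -> data -> Prop) :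
  polytime D i o1 -> polytime D i o2 ->
  polytime D i (fun a w => exists w1 w2, [/\ w = DPair w1 w2, o1 a w1 & o2 a w2]).
Proof.
move=> [p [q pP]] [p' [q' p'P]].
exists (Fork p p'), (q + q' + 'X + (q + q' + 1)) => a v Da iav.
have [w1 [t1 [e1 t1q o1w]]] := pP a v Da iav.
have [w2 [t2 [e2 t2q o2w]]] := p'P a v Da iav.
exists (DPair w1 w2); eexists; split; first exact: EFork e1 e2.
  have h1 := leq_trans (exec_output_le e1) t1q.
  have h2 := leq_trans (exec_output_le e2) t2q.
  have -> : (q + q' + 'X + (q + q' + 1)).[dsize v] =
      (q.[dsize v] + q'.[dsize v] + dsize v + (q.[dsize v] + q'.[dsize v] + 1))%N.
    by rewrite !hornerD hornerX hornerC.
  rewrite /=; lia.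
by exists w1, w2.
Qed.

Lemma polytime_straight (i : A -> data -> Prop) p : straight p ->
  polytime D i (fun a w => exists2 v, i a v & w = run p v).
Proof.
move=> /straight_exec[k kP]; exists p, (k%:P * 'X) => a v Da iav.
have [t e tk] := kP v; exists (run p v), t; split=> //; last by exists v.
by rewrite hornerM hornerC hornerX.
Qed.

End Polytime.

(** * Mapping a straight program over two lists in polynomial time *)

Definition zip_state (ls hs : seq data) (e : data) (acc : seq data) : data :=
  DPair (DPair (dlist ls) (dlist hs)) (DPair e (dlist acc)).

(** Lists end in the integer [0], so being a pair means being nonempty; the first list suffices when
    the lengths agree. *)
Definition zip_more : prog := Seq (Seq (Prim PFst) (Prim PFst)) (Prim PIsPair).

(** Both heads are popped, and the value of [f] on them and on the parameter [e] is pushed onto the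
    accumulator. *)
Definition zip_body (f : prog) : prog :=
  Fork (Fork (Seq (Seq (Prim PFst) (Prim PFst)) (Prim PSnd))
             (Seq (Seq (Prim PFst) (Prim PSnd)) (Prim PSnd)))
       (Fork (Seq (Prim PSnd) (Prim PFst))
             (Fork (Seq (Fork (Seq (Seq (Prim PFst) (Prim PFst)) (Prim PFst))
                              (Fork (Seq (Seq (Prim PFst) (Prim PSnd)) (Prim PFst))
                                    (Seq (Prim PSnd) (Prim PFst)))) f)
                   (Seq (Prim PSnd) (Prim PSnd)))).

Definition zip_run (f : prog) (e : data) (ls hs : seq data) : seq data :=
  [seq run f (DPair xy.1 (DPair xy.2 e)) | xy <- zip ls hs].

(* [l * S] bounds the size of each new item, hence [B] that of every state. *)
Lemma zip_loop_exec f : straight f ->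
  exists k l, forall ls hs e acc S B, size ls = size hs ->
    (dsize (DPair (dlist ls) (dlist hs)) + dsize e < S)%N ->
    (dsize (zip_state ls hs e acc) + size ls * (l * S).+1 <= B)%N ->
  exists2 t,
    exec (While zip_more (zip_body f)) (zip_state ls hs e acc)
      (zip_state [::] [::] e (catrev (zip_run f e ls hs) acc)) t &
    (t <= (size ls).+1 * (k * B))%N.
Proof.
move=> sf.
have [kc cP] : exists k, forall v, exists2 t,
    exec zip_more v (run zip_more v) t & (t <= k * dsize v)%N.
  exact: straight_exec.
have [kb bP] : exists k, forall v, exists2 t,
    exec (zip_body f) v (run (zip_body f) v) t & (t <= k * dsize v)%N.
  by apply: straight_exec; rewrite /= sf.
have [l fP] := straight_exec sf.
(* The three terms account for the test, the body and the charge of [While] itself in one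
   iteration. *)
exists (kc + kb + 1)%N, l => ls; elim: ls => [|x ls IH] [|y hs] e acc S B //=.
- move=> _ _ SB.
  have [t et tk] := cP (zip_state [::] [::] e acc).
  eexists; first by apply: EWhileF et _.
  rewrite mul1n; apply: leq_trans (_ : (kc + kb + 1) * dsize (zip_state [::] [::] e acc) <= _)%N.
    by rewrite mulnDl mul1n leq_add2r (leq_trans tk)// leq_mul2r leq_addr orbT.
  by rewrite leq_mul2l (leq_trans (leq_addr _ _) SB) orbT.
- move=> [sz] SS SB.
  have [t1 et1 tk1] := cP (zip_state (x :: ls) (y :: hs) e acc).
  have [t2 et2 tk2] := bP (zip_state (x :: ls) (y :: hs) e acc).
  pose z := run f (DPair x (DPair y e)).
  have zS : (dsize z <= l * S)%N.
    have [t0 e0 t0l] := fP (DPair x (DPair y e)).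
    apply: leq_trans (exec_output_le e0) (leq_trans t0l _).
    by rewrite leq_mul2l; apply/orP; right; move: SS => /=; lia.
  have sizeE : (dsize (zip_state ls hs e (z :: acc)) + size ls * (l * S).+1 <= B)%N.
    move: SB; rewrite /zip_state /= mulSn; lia.
  have [|t3 et3 tk3] := IH hs e (z :: acc) S B sz _ sizeE.
    by move: SS => /=; lia.
  eexists; first exact: EWhileT et1 _ et2 et3.
  have : (dsize (zip_state (x :: ls) (y :: hs) e acc) <= B)%N.
    by move: SB; rewrite /zip_state /=; lia.
  move: tk1 tk2; set N := dsize _ => tk1 tk2 NB.
  apply: leq_trans (_ : (kc + kb + 1) * N + t3 <= _)%N.
    by rewrite !mulnDl mul1n; lia.
  by rewrite mulSn leq_add// leq_mul2l NB orbT.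
Qed.

Lemma size_le_dlist (s : seq data) : (size s < dsize (dlist s))%N.
Proof. by elim: s => //= x s IH; lia. Qed.

Section ZipMap.
Let A : Type := (seq data * seq data * data)%type.
Let D (a : A) : Prop := size a.1.1 = size a.1.2.

Lemma polytime_zip_loop f : straight f ->
  polytime D (fun a v => v = zip_state a.1.1 a.1.2 a.2 [::])
    (fun a w => w = zip_state [::] [::] a.2 (rev (zip_run f a.2 a.1.1 a.1.2))).
Proof.
move=> /zip_loop_exec[k [l P]].
exists (While zip_more (zip_body f)), ('X * (k%:P * ('X + 'X * (l%:P * 'X + 1)))).
move=> [[ls hs] e] v; rewrite /D /= => sz ->.
set N := dsize _.
(* The start has size [N], and at most [N] items are added, each of size at most [l * N]. *)
have [||t et tk] := P ls hs e [::] N (N + N * (l * N).+1)%N sz.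
- by rewrite /N /zip_state /=; lia.
- rewrite leq_add2l leq_mul2r; apply/orP; right.
  by have := size_le_dlist ls; rewrite /N /zip_state /=; lia.
exists (zip_state [::] [::] e (rev (zip_run f e ls hs))), t; split=> //.
apply: leq_trans tk _.
rewrite !(hornerM, hornerD, hornerX, hornerC).
have -> : (N * (k * (N + N * (l * N + 1))))%R = (N * (k * (N + N * (l * N).+1)))%N.
  by rewrite -addn1.
rewrite leq_mul2r; apply/orP; right.
by have := size_le_dlist ls; rewrite /N /zip_state /=; lia.
Qed.

(* The loop outputs its list in reverse order; running it once more restores the order. *)
Lemma polytime_zip_map f : straight f ->
  polytime D (fun a v => v = DPair (DPair (dlist a.1.1) (dlist a.1.2)) a.2)
    (fun a w => w = dlist (zip_run f a.2 a.1.1 a.1.2)).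
Proof.
move=> sf.
pose zero := Prim (PConst (DInt 0)).
pose accum := Seq (Prim PSnd) (Prim PSnd).
have start := @polytime_straight A D
  (fun a v => v = DPair (DPair (dlist a.1.1) (dlist a.1.2)) a.2)
  (Fork (Prim PFst) (Fork (Prim PSnd) zero)) erefl.
have loop := polytime_seq start (polytime_zip_loop sf) (o := fun a w =>
  w = zip_state [::] [::] a.2 (rev (zip_run f a.2 a.1.1 a.1.2))) _.
have {}loop := loop ltac:(by move=> a u Da [v -> ->]; exists a).
(* The reversed list is zipped with itself, so that [PFst] as item program merely copies each
   element. *)
have restart := polytime_seq loop (polytime_straight D
   (fun a v => v = zip_state [::] [::] a.2 (rev (zip_run f a.2 a.1.1 a.1.2)))
   (p := Fork (Fork accum accum) (Fork zero zero)) erefl) (o := fun a w =>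
   w = let s := rev (zip_run f a.2 a.1.1 a.1.2) in zip_state s s (DInt 0) [::]) _.
have {}restart := restart ltac:(by move=> a u Da ->; exists a; split => // w [v -> ->]).
have fstK s : zip_run (Prim PFst) (DInt 0) s s = s.
  by elim: s => // x s IH; congr (_ :: _).
have reverse := polytime_seq restart (polytime_zip_loop (f := Prim PFst) erefl)
  (o := fun a w => w = zip_state [::] [::] (DInt 0) (zip_run f a.2 a.1.1 a.1.2)) _.
have {}reverse := reverse ltac:(move=> a u Da ->;
  exists (rev (zip_run f a.2 a.1.1 a.1.2), rev (zip_run f a.2 a.1.1 a.1.2), DInt 0);
  by split => //= w ->; rewrite fstK revK).
apply: (polytime_seq reverse (polytime_straight D
   (fun a v => v = zip_state [::] [::] (DInt 0) (zip_run f a.2 a.1.1 a.1.2))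
   (p := accum) erefl)) => a u Da ->.
by exists a; split => // w [v -> ->].
Qed.

End ZipMap.

(** * Approximation *)

Section RiskBound.
Variables (R : realType) (I : instance R).
Hypothesis feas0 : forall x, feas I x -> forall i, 0 <= x ord0 i.
Hypotheses (BQ : BUM (distortion I)) (cQc : concave_on01 (distortion I)).
Hypothesis unif : forall i,
  uniform_on (ratr (lo I ord0 i)) (ratr (hi I ord0 i)) (cost I i).
Hypothesis lo0 : forall i, 0 <= lo I ord0 i.

Let J := int01 (distortion I).
Let l i : R := ratr (lo I ord0 i).
Let h i : R := ratr (hi I ord0 i).
Let Cb i : ae_bounded (cost I i) (l i) (h i). Proof. exact: (uniform_ae_bounded (unif i)). Qed.

Lemma total_costE (x : 'rV[R]_(nvar I)) w :
  total_cost x w = \sum_i x ord0 i * cost I i w.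
Proof. by rewrite /total_cost mfun_sum; apply: eq_bigr. Qed.

Lemma cQE i : cQ I ord0 i = l i + (h i - l i) * J.
Proof. by rewrite mxE; exact: (rho_uniform (unif i) BQ cQc). Qed.

Lemma risk_le_linear_cost x : feas I x -> risk x <= linear_cost x.
Proof.
move=> /feas0 x0.
apply: le_trans (rho_subadditive BQ cQc x0 Cb (total_costE x)) _.
by apply: ler_sum => i _; rewrite mxE mulrC.
Qed.

Lemma linear_cost_le_risk x : feas I x -> linear_cost x <= betaL I * risk x.
Proof.
move=> /feas0 x0; have J1 : 1 <= 2 * J := int01_ge_half BQ cQc.
have l0 i : 0 <= l i by rewrite /l ler0q.
apply: (@le_trans _ _ (2 * J * \sum_i x ord0 i * stop_loss (cost I i) 0)).
  rewrite mulr_sumr; apply: ler_sum => i _.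
  rewrite cQE mulrCA mulrC ler_wpM2l//.
  (* Here [l + (h - l) * J <= J * (l + h)] because [l <= 2 * J * l], and [l + h] is at most twice
     the stop-loss at [0]. *)
  have := uniform_mean (unif i); rewrite -/(l i) -/(h i); have := l0 i.
  set s := stop_loss _ _ => li0 hs. nra.
rewrite /betaL -/J; apply: ler_wpM2l; first exact: le_trans ler01 J1.
apply: le_trans (stop_loss_comb_ge x0 Cb (total_costE x) l0) _.
apply: (stop_loss0_le_rho BQ cQc (ae_bounded_comb x0 Cb (total_costE x))).
by apply: sumr_ge0 => i _; rewrite mulr_ge0.
Qed.

Lemma linear_minimizer_risk x y : minimizer (@linear_cost R I) x -> feas I y ->
  risk x <= betaL I * risk y.
Proof.
move=> [fx xmin] fy; apply: le_trans (risk_le_linear_cost fx) _.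
exact: le_trans (xmin y fy) (linear_cost_le_risk fy).
Qed.

End RiskBound.

(** * Computing the cost vector and reducing to the linear problem *)

Definition binop (o : prim) (p q : prog) : prog := Seq (Fork p q) (Prim o).

(* On [(x, (y, z))] holding three fractions, a fraction for [x + (y - x) * z]. *)
Definition interp_prog : prog :=
  let xn := Seq (Prim PFst) (Prim PFst) in
  let xd := Seq (Prim PFst) (Prim PSnd) in
  let yn := Seq (Seq (Prim PSnd) (Prim PFst)) (Prim PFst) in
  let yd := Seq (Seq (Prim PSnd) (Prim PFst)) (Prim PSnd) in
  let zn := Seq (Seq (Prim PSnd) (Prim PSnd)) (Prim PFst) in
  let zd := Seq (Seq (Prim PSnd) (Prim PSnd)) (Prim PSnd) in
  Fork (binop PAdd (binop PMul (binop PMul xn yd) zd)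
          (binop PMul (binop PSub (binop PMul yn xd) (binop PMul xn yd)) zn))
       (binop PMul (binop PMul xd yd) zd).

Lemma interp_progP (R : realType) (r s : rat) (v : data) (z : R) :
  encodes_num v z ->
  encodes_num (run interp_prog (DPair (code_rat r) (DPair (code_rat s) v)))
    (ratr r + (ratr s - ratr r) * z).
Proof.
move=> [a [b [-> b0 ->]]].
exists (numq r * denq s * b + (numq s * denq r - numq r * denq s) * a),
  (denq r * denq s * b); split => //; first by rewrite !mulr_gt0.
rewrite /ratr !(intrD, intrM, rmorphB, rmorphD, rmorphM) /=.
have dr : (denq r)%:~R != 0 :> R by rewrite intr_eq0.
have ds : (denq s)%:~R != 0 :> R by rewrite intr_eq0.
have db : b%:~R != 0 :> R by rewrite intr_eq0 gt_eqF.
by field; rewrite dr ds db.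
Qed.

Lemma encodes_cQ (R : realType) (I : instance R) (v : data) :
  (forall i, cQ I ord0 i = ratr (lo I ord0 i) +
     (ratr (hi I ord0 i) - ratr (lo I ord0 i)) * int01 (distortion I)) ->
  encodes_num v (int01 (distortion I)) ->
  encodes_vec (dlist (zip_run interp_prog v
    [seq code_rat (lo I ord0 i) | i <- enum 'I_(nvar I)]
    [seq code_rat (hi I ord0 i) | i <- enum 'I_(nvar I)])) (cQ I).
Proof.
move=> cQi vP.
exists (mktuple (fun i => run interp_prog
  (DPair (code_rat (lo I ord0 i)) (DPair (code_rat (hi I ord0 i)) v)))).
  by congr dlist; rewrite /zip_run zip_map -map_comp.
by move=> i; rewrite tnth_mktuple cQi; exact: interp_progP.
Qed.

Theorem theorem4 (R : realType) (Pb : instance R -> Prop)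
  (feas_ge0 : forall I, Pb I -> forall x, feas I x ->
     forall i, 0 <= x ord0 i)
  (dist_BUM : forall I, Pb I -> BUM (distortion I))
  (dist_concave : forall I, Pb I -> concave_on01 (distortion I))
  (cost_indep : forall I, Pb I -> independent_RVs (cost I))
  (cost_unif : forall I, Pb I -> forall i,
     uniform_on (ratr (lo I ord0 i)) (ratr (hi I ord0 i)) (cost I i))
  (lo_ge0 : forall I, Pb I -> forall i, 0 <= lo I ord0 i)
  (int_polytime : polytime Pb (@presents R)
     (fun I w => encodes_num w (int01 (distortion I))))
  (linear_polytime : polytime Pb (@presents_linear R)
     (fun I w => exists2 x : 'rV[R]_(nvar I),
        encodes_vec w x & minimizer (@linear_cost R I) x)) :
  approximable Pb (@risk R) (@betaL R).
Proof.
(* The identity program keeps the instance at hand beside the numbers computed from it. *)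
have keep : polytime Pb (@presents R) (fun I w => exists2 v, presents I v & w = v).
  exact: (polytime_straight Pb (@presents R) (p := Prim PId)).
(* This drops [desc I] and leaves the supports paired with the computed integral, as
   [polytime_zip_map] expects. *)
pose arg := Fork (Seq (Prim PFst) (Prim PFst)) (Prim PSnd).
have cQ_polytime : polytime Pb (@presents R) (fun I w => encodes_vec w (cQ I)).
  have paired : polytime Pb (@presents R) (fun I w =>
      exists2 u, w = DPair (DPair (code_vec (lo I)) (code_vec (hi I))) u &
        encodes_num u (int01 (distortion I))).
    apply: (polytime_seq (polytime_fork keep int_polytime) (polytime_straight Pb
      (fun I v => exists2 u, v = DPair (Defs.code I) u & encodes_num u (int01 (distortion I)))
      (p := arg) erefl)).
    move=> I _ PI [_ [u [-> [_ -> ->] uP]]].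
    by exists I; split => //; [exists u|move=> w [_ [u' -> u'P] ->]; exists u'].
  apply: (polytime_seq paired (polytime_zip_map (f := interp_prog) erefl)).
  move=> I _ PI [u -> uP].
  exists ([seq code_rat (lo I ord0 i) | i <- enum 'I_(nvar I)],
          [seq code_rat (hi I ord0 i) | i <- enum 'I_(nvar I)], u).
  split => //=; first by rewrite !size_map.
  move=> w ->; apply: encodes_cQ => // i.
  by apply: cQE; [exact: dist_BUM|exact: dist_concave|exact: cost_unif].
(* The solver of the linear problem receives the instance with its computed cost vector, and its
   minimizer is output unchanged. *)
apply: (polytime_seq (polytime_fork keep cQ_polytime) linear_polytime).
move=> I _ PI [_ [u [-> [_ -> ->] uP]]].
exists I; split => //; first by exists u.
move=> w [x wx xmin]; exists x; split => //; first by case: xmin.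
move=> y fy; apply: linear_minimizer_risk => //.
- exact: feas_ge0.
- exact: dist_BUM.
- exact: dist_concave.
- exact: cost_unif.
- exact: lo_ge0.
Qed.
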